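(* Let $(X,A_X)$ and $(Y,A_Y)$ be dissimilarity networks, and let $p\ge 0$ be an integer. Then $$d_{\mathrm{B}}\big(\mathrm{Dgm}_p(X,A_X),\mathrm{Dgm}_p(Y,A_Y)\big)\le 2\,d_{\mathcal{N}}\big((X,A_X),(Y,A_Y)\big),$$ where $\mathrm{Dgm}_p$ denotes the $p$-dimensional path persistence diagram, $d_{\mathrm{B}}$ the bottleneck distance and $d_{\mathcal{N}}$ the network distance.
   Context: Fix a field $\mathbb{K}$. For a finite set $S$, $\mathbb{K}[S]$ denotes the free $\mathbb{K}$-vector space on $S$. Write $\mathbb{Z}_+$, $\mathbb{R}_+$ for the nonnegative integers and reals, and $\overline{\mathbb{R}}=[-\infty,\infty]$. **Networks and network distance.** A (dissimilarity) network is a finite nonempty set $X$ with a weight function $A_X:X\times X\to\mathbb{R}_+$ such that $A_X(x,y)=0$ if and only if $x=y$. No symmetry or triangle inequality is assumed. A correspondence between $X$ and $Y$ is a subset $R\subseteq X\times Y$ whose projections to $X$ and to $Y$ are both surjective; $\mathscr{R}(X,Y)$ is the set of all correspondences. The distortion of $R$ is $\mathrm{dis}(R):=\max_{(x,y),(x',y')\in R}|A_X(x,x')-A_Y(y,y')|$, and $d_{\mathcal{N}}((X,A_X),(Y,A_Y)):=\tfrac12\min_{R\in\mathscr{R}(X,Y)}\mathrm{dis}(R)$. **Regular paths.** For a finite set $X$ and $p\in\mathbb{Z}_+$, an elementary $p$-path is a sequence $[x_0,\dots,x_p]$ of elements of $X$; it is regular if $x_i\ne x_{i+1}$ for all $0\le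 i\le p-1$ and irregular otherwise. Let $\Lambda_p(X)$ be the free $\mathbb{K}$-vector space on all elementary $p$-paths, $\mathcal{I}_p(X)$ the subspace spanned by the irregular ones, and $\mathcal{R}_p(X)$ the subspace spanned by the regular ones. Set $\Lambda_{-1}:=\mathbb{K}$, $\Lambda_{-2}:=\{0\}$. The non-regular boundary map $\partial_p^{\mathrm{nr}}:\Lambda_p\to\Lambda_{p-1}$ is the linear map with $\partial_p^{\mathrm{nr}}[x_0,\dots,x_p]=\sum_{i=0}^p(-1)^i[x_0,\dots,\widehat{x_i},\dots,x_p]$ (for $p=0$, the empty path is identified with $1\in\mathbb{K}$), and $\partial_{-1}^{\mathrm{nr}}:=0$. One has $\partial_p^{\mathrm{nr}}(\mathcal{I}_p)\subseteq\mathcal{I}_{p-1}$, and the regular boundary map $\partial_p:\mathcal{R}_p\to\mathcal{R}_{p-1}$ is the map induced via the natural isomorphism $\mathcal{R}_p\cong\Lambda_p/\mathcal{I}_p$ (i.e. apply $\partial_p^{\mathrm{nr}}$ and replace irregular paths by $0$); in degree $-1$ the space is $\mathbb{K}$. **Path homology.** A digraph is a pair $G=(X,E)$ with $X$ finite and $E\subseteq X\times X$ containing no self-loops. An elementary $p$-path $[x_0,\dots,x_p]$ is allowed on $G$ if $(x_i,x_{i+1})\in E$ for all $0\le i\le p-1$. Let $\mathcal{A}_p(G)$ be the free $\mathbb{K}$-vector space on allowed $p$-paths, $\mathcal{A}_{-1}:=\mathbb{K}$, $\mathcal{A}_{-2}:=\{0\}$. The space of $\partial$-invariant $p$-paths is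 $\Omega_p(G):=\{c\in\mathcal{A}_p(G):\partial_p c\in\mathcal{A}_{p-1}(G)\}$ for $p\in\mathbb{Z}_+$, with $\Omega_{-1}:=\mathbb{K}$, $\Omega_{-2}:=\{0\}$. The maps $\partial_p$ restrict to a chain complex $\cdots\to\Omega_2\to\Omega_1\to\Omega_0\to\mathbb{K}\to 0$, and for $p\in\mathbb{Z}_+$, $H_p(G):=\ker(\partial_p|_{\Omega_p})/\operatorname{im}(\partial_{p+1}|_{\Omega_{p+1}})$. **Persistent path homology.** For a network $(X,A_X)$ and $\delta\in\mathbb{R}_+$, let $\mathfrak{G}_X^\delta=(X,E_X^\delta)$ with $E_X^\delta:=\{(x,x')\in X\times X: x\ne x',\ A_X(x,x')\le\delta\}$. For $\delta\le\delta'$ the inclusion $\iota_{\delta,\delta'}:\mathfrak{G}_X^\delta\hookrightarrow\mathfrak{G}_X^{\delta'}$ (identity on vertices) induces the inclusion of chain complexes $\Omega_\bullet(\mathfrak{G}_X^\delta)\subseteq\Omega_\bullet(\mathfrak{G}_X^{\delta'})$ and hence linear maps $(\iota_{\delta,\delta'})_\#$ on homology. The $p$-dimensional persistent path homology is the persistent vector space $\mathcal{H}_p(X,A_X):=\{H_p(\mathfrak{G}_X^\delta)\xrightarrow{(\iota_{\delta,\delta'})_\#}H_p(\mathfrak{G}_X^{\delta'})\}_{\delta\le\delta'\in\mathbb{R}_+}$. **Persistence diagram.** This family consists of finite-dimensional spaces and changes (up to isomorphism via the structure maps) at only finitely many values of $\delta$. Its persistence barcode is the multiset of half-open intervals $[b,d)$,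 with $0\le b<d\le\infty$, recording births and deaths of elements of compatible bases; equivalently, the unique multiset of intervals such that the family is isomorphic to the direct sum of the corresponding interval persistent vector spaces ($\mathbb{K}$ at each $\delta\in[b,d)$, with identity maps between these copies, and $0$ elsewhere). The $p$-dimensional path persistence diagram $\mathrm{Dgm}_p(X,A_X)$ is the corresponding multiset of points $(b,d)\in\overline{\mathbb{R}}^2$, with the same multiplicities. **Bottleneck distance.** For multisets $A,B$ of points in $\overline{\mathbb{R}}^2$, $d_{\mathrm{B}}(A,B):=\inf\{\sup_{a\in A\cup\Delta^\infty}\|a-\varphi(a)\|_\infty : \varphi:A\cup\Delta^\infty\to B\cup\Delta^\infty\text{ a bijection}\}$, where $\Delta^\infty$ is the multiset of all points of the diagonal, each with infinite multiplicity, and $\|(s,t)-(s',t')\|_\infty:=\max(|s-s'|,|t-t'|)$ (with $|\infty-\infty|=0$). *)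

(* Defs.v *)
From HB Require Import structures.
From mathcomp Require Import all_boot all_order all_algebra.
From mathcomp Require Import ring_quotient finmap multiset.
From mathcomp Require Import all_classical all_reals all_analysis.

Set Implicit Arguments.
Unset Strict Implicit.
Unset Printing Implicit Defensive.

Import Order.TTheory GRing.Theory Num.Theory.

Local Open Scope ring_scope.

Section Networks.
Variable R : realType.

Record network := Network {
  net_pt :> finType;
  net_wt : net_pt -> net_pt -> R;
  net_pt_neq0 : (0 < #|net_pt|)%N;
  net_wt_ge0 : forall x y, 0 <= net_wt x y;
  net_wt_eq0 : forall x y, net_wt x y = 0 <-> x = y }.

Definition correspondence (X Y : finType) (C : {set X * Y}) : bool :=
  [forall x, [exists y, (x, y) \in C]] && [forall y, [exists x, (x, y) \in C]].

Definition dis (X Y : network) (C : {set X * Y}) : R :=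
  \big[Num.max/0]_(u in C) \big[Num.max/0]_(v in C)
     `|net_wt u.1 v.1 - net_wt u.2 v.2|.

(* [setT] is a correspondence because networks are nonempty, so the arg min is
   a correspondence of minimal distortion. *)
Definition dN (X Y : network) : R :=
  2^-1 * dis [arg min_(C < [set: X * Y] | correspondence C) dis C]%O.

End Networks.

Section PathComplex.
Variables (K : fieldType) (X : finType).

(* [chain n] is the space of (n-1)-chains: elementary paths are indexed by their
   number n of vertices. In particular [chain 0], spanned by the empty path, is
   the copy of K in degree -1. *)
Definition chain (n : nat) := {ffun n.-tuple X -> K^o}.

Definition elem n (x : n.-tuple X) : chain n := [ffun y => (y == x)%:R].

Definition face n (x : n.+1.-tuple X) (i : 'I_n.+1) : n.-tuple X :=
  [tuple tnth x (lift i j) | j < n].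

Definition bd_nr_fun n (c : chain n.+1) : chain n :=
  \sum_x c x *: \sum_(i < n.+1) (-1) ^+ i *: elem (face x i).

Definition bd_nr n : 'Hom(chain n.+1, chain n) := linfun (@bd_nr_fun n).

Definition regular_path n (x : n.-tuple X) : bool :=
  sorted (fun a b => a != b) x.

Definition reg_fun n (c : chain n) : chain n :=
  [ffun x => if regular_path x then c x else 0].

Definition reg n : 'End(chain n) := linfun (@reg_fun n).

(* Regular chains are viewed inside all chains, so that passing to the quotient
   by irregular paths amounts to killing the irregular coefficients. *)
Definition bd n : 'Hom(chain n.+1, chain n) := (reg n \o bd_nr n)%VF.

Fact bd_nr_fun_linear n : linear (@bd_nr_fun n).
Proof.
move=> a u v; rewrite /bd_nr_fun scaler_sumr -big_split /=.
by apply: eq_bigr => x _; rewrite !ffunE scalerDl scalerA.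
Qed.
HB.instance Definition _ n :=
  GRing.isLinear.Build K (chain n.+1) (chain n) _ (@bd_nr_fun n)
    (@bd_nr_fun_linear n).

Fact reg_fun_linear n : linear (@reg_fun n).
Proof.
move=> a u v; apply/ffunP => x; rewrite !ffunE.
by case: ifP => // _; rewrite scaler0 addr0.
Qed.
HB.instance Definition _ n :=
  GRing.isLinear.Build K (chain n) (chain n) _ (@reg_fun n) (@reg_fun_linear n).

Fact elemE n (x y : n.-tuple X) : elem x y = (y == x)%:R.
Proof. by rewrite ffunE. Qed.

Fact bd_nr_elem n (x : n.+1.-tuple X) :
  bd_nr n (elem x) = \sum_(i < n.+1) (-1) ^+ i *: elem (face x i).
Proof.
rewrite lfunE /= /bd_nr_fun (bigD1 x) //= elemE eqxx scale1r.
rewrite [X in _ + X]big1 ?addr0 // => y /negPf yx.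
by rewrite elemE yx scale0r.
Qed.

Fact reg_elem n (x : n.-tuple X) :
  reg n (elem x) = if regular_path x then elem x else 0.
Proof.
rewrite lfunE; apply/ffunP => y; rewrite /= ffunE elemE.
case: eqP => [->|/eqP/negPf yx]; first by case: ifP => rx; rewrite ?elemE ?eqxx ?ffunE.
by rewrite if_same; case: ifP => _; rewrite ?elemE ?yx ?ffunE.
Qed.

End PathComplex.

Record digraph (X : finType) := Digraph {
  edge :> rel X;
  edge_irr : irreflexive edge }.

Section PathHomology.
Variables (K : fieldType) (X : finType).
Implicit Types G : digraph X.

Definition allowed G n : {vspace chain K X n} :=
  <<[seq elem K x | x in [pred x : n.-tuple X | sorted (edge G) x]]>>%VS.

(* From here on p is the degree: Omega G p lives in chain p.+1. *)
Definition Omega G p : {vspace chain K X p.+1} :=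
  (allowed G p.+1 :&: (bd K X p @^-1: allowed G p))%VS.

Definition cycles G p : {vspace chain K X p.+1} :=
  (Omega G p :&: lker (bd K X p))%VS.

Definition boundaries G p : {vspace chain K X p.+1} :=
  (bd K X p.+1 @: Omega G p.+1)%VS.

Fact allowedS G G' n : subrel G G' -> (allowed G n <= allowed G' n)%VS.
Proof.
move=> sGG'; apply/span_subvP => _ /fintype.imageP[x Gx ->].
by apply/memv_span/fintype.image_f/(sub_sorted sGG' Gx).
Qed.

Fact OmegaS G G' p : subrel G G' -> (Omega G p <= Omega G' p)%VS.
Proof.
move=> sGG'; by apply: capvS; [|apply: lpreimS]; apply: allowedS.
Qed.

Fact cyclesS G G' p : subrel G G' -> (cycles G p <= cycles G' p)%VS.
Proof. by move=> sGG'; apply: capvS => //; apply: OmegaS. Qed.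

Fact boundariesS G G' p : subrel G G' -> (boundaries G p <= boundaries G' p)%VS.
Proof. by move=> sGG'; apply/limgS/OmegaS. Qed.

End PathHomology.

Section SubQuotient.
Variables (K : fieldType) (V : vectType K).
Implicit Types Z B : {vspace V}.

Definition in_sub Z B : pred (subvs_of Z) := fun z => vsval z \in B.

Fact in_sub_zmod_closed Z B : zmod_closed (@in_sub Z B).
Proof.
by split=> [|x y]; [exact: mem0v | exact: rpredB].
Qed.
HB.instance Definition _ Z B :=
  GRing.isZmodClosed.Build _ (@in_sub Z B) (@in_sub_zmod_closed Z B).

Definition in_sub_closed Z B : zmodClosed (subvs_of Z) :=
  GRing.ZmodClosed.clone _ (@in_sub Z B) _.

(* Z / (Z :&: B), that is Z / B when B is included in Z *)
Definition subquot Z B := Quotient.quot (in_sub_closed Z B).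
HB.instance Definition _ Z B := GRing.Zmodule.on (subquot Z B).
HB.instance Definition _ Z B := EqQuotient.on (subquot Z B).

Definition pi_sq Z B (z : subvs_of Z) : subquot Z B := (\pi_(subquot Z B) z)%qT.

Fact pi_sqP Z B (z z' : subvs_of Z) :
  reflect (pi_sq B z = pi_sq B z') (vsval z - vsval z' \in B).
Proof.
rewrite -raddfB -[_ \in B]/(z - z' \in @in_sub Z B) Quotient.idealrBE.
exact: eqP.
Qed.

Fact pi_sqB Z B : zmod_morphism (@pi_sq Z B).
Proof. exact: (raddfB (\pi_(Quotient.quot (in_sub_closed Z B)))%qT). Qed.
HB.instance Definition _ Z B :=
  GRing.isZmodMorphism.Build _ _ (@pi_sq Z B) (@pi_sqB Z B).

Fact repr_sqK Z B (q : subquot Z B) : pi_sq B (repr q) = q.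
Proof. exact: reprK. Qed.

Definition scale_sq Z B (a : K) (q : subquot Z B) : subquot Z B :=
  pi_sq B (a *: repr q).

Fact scale_sq_pi Z B a (z : subvs_of Z) :
  scale_sq a (pi_sq B z) = pi_sq B (a *: z).
Proof.
have /pi_sqP dB := repr_sqK (pi_sq B z).
apply/pi_sqP; have := memvZ a dB; rewrite scalerBr. exact.
Qed.

Fact scale_sqA Z B a b (q : subquot Z B) :
  scale_sq a (scale_sq b q) = scale_sq (a * b) q.
Proof. by rewrite -[q]repr_sqK !scale_sq_pi scalerA. Qed.
Fact scale_sq1 Z B : left_id 1 (@scale_sq Z B).
Proof. by move=> q; rewrite -[q]repr_sqK scale_sq_pi scale1r. Qed.
Fact scale_sqDr Z B : right_distributive (@scale_sq Z B) +%R.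
Proof.
move=> a q r; rewrite -[q]repr_sqK -[r]repr_sqK -raddfD !scale_sq_pi.
by rewrite scalerDr raddfD.
Qed.
Fact scale_sqDl Z B q : {morph (@scale_sq Z B)^~ q : a b / a + b}.
Proof.
by move=> a b; rewrite -[q]repr_sqK !scale_sq_pi scalerDl raddfD.
Qed.
HB.instance Definition _ Z B :=
  GRing.Zmodule_isLmodule.Build K (subquot Z B)
    (@scale_sqA Z B) (@scale_sq1 Z B) (@scale_sqDr Z B) (@scale_sqDl Z B).

Fact pi_sqZ Z B : scalable (@pi_sq Z B).
Proof. by move=> a z; rewrite -scale_sq_pi. Qed.
HB.instance Definition _ Z B :=
  GRing.isScalable.Build _ _ _ _ (@pi_sq Z B) (@pi_sqZ Z B).

(* Under the inclusions below, [vsproj Z'] is the inclusion of Z in Z'. *)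
Definition subquot_map_fun Z B Z' B' (q : subquot Z B) : subquot Z' B' :=
  pi_sq B' (vsproj Z' (vsval (repr q))).

Section Map.
Variables (Z B Z' B' : {vspace V}) (sZ : (Z <= Z')%VS) (sB : (B <= B')%VS).

Fact subquot_map_pi (z : subvs_of Z) :
  subquot_map_fun Z' B' (pi_sq B z) = pi_sq B' (vsproj Z' (vsval z)).
Proof.
apply/pi_sqP; rewrite !vsprojK ?(subvP sZ) ?subvsP //; apply: (subvP sB).
by apply/pi_sqP/repr_sqK.
Qed.

Fact subquot_map_linear : linear (@subquot_map_fun Z B Z' B').
Proof.
move=> a q r; rewrite -[q]repr_sqK -[r]repr_sqK -linearP !subquot_map_pi.
by rewrite !linearP.
Qed.

Definition subquot_map : {linear subquot Z B -> subquot Z' B'} :=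
  HB.pack (@subquot_map_fun Z B Z' B')
    (GRing.isLinear.Build _ _ _ _ _ subquot_map_linear).
End Map.

End SubQuotient.

Section PersistentVectorSpaces.
Variables (K : fieldType) (R : realType).

Record persvect := PersVect {
  pv_sp :> {nonneg R} -> lmodType K;
  pv_map : forall s t, s <= t -> {linear pv_sp s -> pv_sp t};
  pv_map_id : forall s (h : s <= s) v, pv_map h v = v;
  pv_map_comp : forall s t u (hst : s <= t) (htu : t <= u) (hsu : s <= u) v,
    pv_map htu (pv_map hst v) = pv_map hsu v }.

Definition pv_iso (V W : persvect) : Prop :=
  exists phi : forall t, {linear V t -> W t},
    (forall t, bijective (phi t)) /\
    forall s t (h : s <= t) v, phi t (pv_map V h v) = pv_map W h (phi s v).

Definition dgm_pt := (\bar R * \bar R)%type.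

Definition alive (u : dgm_pt) (t : {nonneg R}) : bool :=
  ((u.1 <= t%:num%:E) && (t%:num%:E < u.2))%E.

Section IntervalSum.
Variable D : seq dgm_pt.

Definition bar (i : 'I_(size D)) : dgm_pt := tnth (in_tuple D) i.

(* The sum over i of the interval spaces of the bars [bar i]: at t it has one
   copy of K for each i such that [bar i] is alive at t. *)
Definition interval_sum_sp (t : {nonneg R}) : lmodType K :=
  {ffun {i : 'I_(size D) | alive (bar i) t} -> K^o}.

Definition interval_sum_fun s t (f : interval_sum_sp s) : interval_sum_sp t :=
  [ffun j => oapp f 0 (insub (val j))].

Fact interval_sum_linear s t : linear (@interval_sum_fun s t).
Proof.
move=> a f g; apply/ffunP => j; rewrite !ffunE.
by case: insubP => [i _ _|_] /=; rewrite ?ffunE // scaler0 addr0.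
Qed.
HB.instance Definition _ s t :=
  GRing.isLinear.Build _ _ _ _ (@interval_sum_fun s t)
    (@interval_sum_linear s t).

Definition interval_sum_map s t (_ : s <= t) :
  {linear interval_sum_sp s -> interval_sum_sp t} := @interval_sum_fun s t.

Fact interval_sum_id s (h : s <= s) v : interval_sum_map h v = v.
Proof. by apply/ffunP => j; rewrite ffunE valK. Qed.

Fact interval_sum_comp s t u (hst : s <= t) (htu : t <= u) (hsu : s <= u) v :
  interval_sum_map htu (interval_sum_map hst v) = interval_sum_map hsu v.
Proof.
apply/ffunP => j; rewrite !ffunE.
case: (insubP _ (val j)) => [k _ kj|ndt] /=; first by rewrite ffunE kj.
case: insubP => [i /andP[bs _] _|//]; case/negP: ndt; have /andP[_ ud] := valP j.
rewrite /alive (le_trans bs) ?lee_fin //=.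
by apply: le_lt_trans ud; rewrite lee_fin.
Qed.

Definition interval_sum : persvect := PersVect interval_sum_id interval_sum_comp.

End IntervalSum.

Definition is_barcode (V : persvect) (D : multiset dgm_pt) : Prop :=
  (forall u, u \in D -> (0 <= u.1)%E /\ (u.1 < u.2)%E) /\
  pv_iso V (interval_sum D).

(* Barcodes are unique when they exist, so this is the barcode of V; the default
   value is only taken by spaces which have no finite barcode. *)
Definition diagram (V : persvect) : multiset dgm_pt :=
  xget mset0 [set D | is_barcode V D]%classic.

End PersistentVectorSpaces.

Section PersistentPathHomology.
Variables (K : fieldType) (R : realType) (X : network R) (p : nat).

Definition net_rel (t : {nonneg R}) : rel X :=
  fun x y => (x != y) && (net_wt x y <= t%:num).

Fact net_rel_irr t : irreflexive (net_rel t).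
Proof. by move=> x; rewrite /net_rel eqxx. Qed.

Definition net_digraph t : digraph X := Digraph (net_rel_irr t).

Fact net_digraphS s t : s <= t -> subrel (net_digraph s) (net_digraph t).
Proof. by move=> st x y /andP[xy h]; rewrite /= /net_rel xy (le_trans h). Qed.

Definition homology (G : digraph X) : lmodType K :=
  subquot (cycles K G p) (boundaries K G p).

Definition homology_map s t (h : s <= t) :
  {linear homology (net_digraph s) -> homology (net_digraph t)} :=
  subquot_map (cyclesS K p (net_digraphS h)) (boundariesS K p (net_digraphS h)).

Fact homology_map_id s (h : s <= s) v : homology_map h v = v.
Proof.
rewrite -[v]repr_sqK [LHS]subquot_map_pi ?subvv //.
by rewrite vsvalK.
Qed.

Fact homology_map_comp s t u (hst : s <= t) (htu : t <= u) (hsu : s <= u) v :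
  homology_map htu (homology_map hst v) = homology_map hsu v.
Proof.
have sc a b (h : a <= b) := cyclesS K p (net_digraphS h).
have sb a b (h : a <= b) := boundariesS K p (net_digraphS h).
rewrite -[v]repr_sqK [homology_map hst _]subquot_map_pi; try by [apply: sc|apply: sb].
rewrite [LHS]subquot_map_pi; try by [apply: sc|apply: sb].
rewrite [RHS]subquot_map_pi; try by [apply: sc|apply: sb].
by rewrite vsprojK // (subvP (sc _ _ hst)) ?subvsP.
Qed.

Definition pers_path_homology : persvect K R :=
  PersVect homology_map_id homology_map_comp.

(* as a multiplicity function *)
Definition Dgm : dgm_pt R -> nat := diagram pers_path_homology.

End PersistentPathHomology.

Section Bottleneck.
Variable R : realType.
Local Open Scope ereal_scope.
Local Open Scope classical_set_scope.

(* The case distinction is needed because +oo - +oo = -oo in \bar R. *)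
Definition ext_dist (s t : \bar R) : \bar R := if s == t then 0 else `|s - t|.

Definition linf_dist (u v : dgm_pt R) : \bar R :=
  maxe (ext_dist u.1 v.1) (ext_dist u.2 v.2).

(* A multiset is given by its multiplicity function; (u, k) is the k-th copy of
   the point u, and a diagonal point has copies (u, k) for all k. *)
Definition with_diag (A : dgm_pt R -> nat) : set (dgm_pt R * nat) :=
  [set w | w.1.1 = w.1.2 \/ (w.2 < A w.1)%N].

Definition bottleneck (A B : dgm_pt R -> nat) : \bar R :=
  ereal_inf
    [set ereal_sup [set linf_dist w.1 (phi w).1 | w in with_diag A]
    | phi in [set phi | set_bij (with_diag A) (with_diag B) phi]].

End Bottleneck.

(* Main.v *)
Require Import Defs.
From HB Require Import structures.
From mathcomp Require Import all_boot all_order all_algebra.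
From mathcomp Require Import finmap multiset.
From mathcomp Require Import ring lra.
From mathcomp Require Import all_classical all_reals all_analysis.

(* A correspondence C carries two weights, pulled back from X and Y, which
   differ by at most dis C. Pulling back along a surjection with a section s
   does not change persistent path homology, because the projection followed
   by s is homotopic to the identity at every scale: each vertex a is joined
   to its image by an edge of weight 0. It remains to compare two weights w,
   w' on one finite set.

   If no two pairs of vertices are ordered in strictly opposite ways by w
   and w', the sublevel digraphs of w and w' together form a chain, and so
   do their spaces of cycles and their spaces of boundaries. Two flags of a
   vector space have a common adapted basis; each basis vector has a birth
   (when it becomes a cycle) and a death (when it becomes a boundary) for w
   and for w', these pairs are the barcodes, and matching by basis vectors
   costs at most sup |w - w'|. In general, move along the segment from w to
   w' until the first crossing, which removes an inversion, and conclude by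
   induction on the number of inversions. *)

Set Implicit Arguments.
Unset Strict Implicit.
Unset Printing Implicit Defensive.

Import Order.TTheory GRing.Theory Num.Theory.

Local Open Scope ring_scope.

(** * Regular chains *)

Section LinearExtension.
Variables (K : fieldType) (X : finType) (n : nat) (W : lmodType K).

Lemma chain_sum_elem (c : chain K X n) : c = \sum_x c x *: elem K x.
Proof.
apply/ffunP => y; rewrite sum_ffunE (bigD1 y) //= !ffunE eqxx big1 ?addr0.
  by rewrite [RHS]mulr1.
by move=> x /negPf xy; rewrite !ffunE eq_sym xy [LHS]mulr0.
Qed.

Lemma chain_linear_ext (f g : {linear chain K X n -> W}) :
  (forall x, f (elem K x) = g (elem K x)) -> f =1 g.
Proof.
move=> fg c; rewrite [c]chain_sum_elem !linear_sum; apply: eq_bigr => x _.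
by rewrite !linearZ fg.
Qed.

Definition chain_lin (F : n.-tuple X -> W) (c : chain K X n) : W :=
  \sum_x c x *: F x.

Fact chain_lin_linear F : linear (chain_lin F).
Proof.
move=> a u v; rewrite /chain_lin scaler_sumr -big_split /=.
by apply: eq_bigr => x _; rewrite !ffunE scalerDl scalerA.
Qed.
HB.instance Definition _ F :=
  GRing.isLinear.Build K (chain K X n) W _ (chain_lin F) (chain_lin_linear F).

Lemma chain_lin_elem F x : chain_lin F (elem K x) = F x.
Proof.
rewrite /chain_lin (bigD1 x) //= elemE eqxx scale1r big1 ?addr0 //.
by move=> y /negPf yx; rewrite elemE yx scale0r.
Qed.

End LinearExtension.

(** * Cones, the boundary map, and its descent to regular chains *)

Section Cone.
Variables (K : fieldType) (X : finType).

Definition cone n (a : X) : chain K X n -> chain K X n.+1 :=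
  chain_lin (fun t => elem K [tuple of a :: t]).
HB.instance Definition _ n a := GRing.Linear.on (@cone n a).

Lemma cone_elem n a (t : n.-tuple X) :
  cone a (elem K t) = elem K [tuple of a :: t].
Proof. exact: chain_lin_elem. Qed.

Lemma face_cons0 n a (t : n.-tuple X) : face [tuple of a :: t] ord0 = t.
Proof. by apply: eq_from_tnth => j; rewrite tnth_mktuple tnthS. Qed.

Lemma face_consS n a (t : n.+1.-tuple X) i :
  face [tuple of a :: t] (lift ord0 i) = [tuple of a :: face t i].
Proof.
apply: eq_from_tnth => j; rewrite tnth_mktuple.
have [{j}j ->|->] := unliftP ord0 j.
  rewrite (_ : lift (lift ord0 i) (lift ord0 j) = lift ord0 (lift i j)).
    by rewrite !tnthS tnth_mktuple.
  by apply: val_inj; rewrite /= /bump /= !add1n ltnS addnS.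
by rewrite (_ : lift (lift ord0 i) ord0 = ord0) ?tnth0 //; apply: val_inj.
Qed.

Lemma bd_nr_cone0 a (c : chain K X 0) : bd_nr K X 0 (cone a c) = c.
Proof.
apply: (@chain_linear_ext _ _ _ _ (bd_nr K X 0 \o cone a) idfun) => t /=.
by rewrite cone_elem bd_nr_elem big_ord1 expr0 scale1r face_cons0.
Qed.

(** Dropping the apex leaves [c]; dropping any other vertex keeps the apex and shifts the sign. *)
Lemma bd_nr_cone n a (c : chain K X n.+1) :
  bd_nr K X n.+1 (cone a c) = c - cone a (bd_nr K X n c).
Proof.
apply: (@chain_linear_ext _ _ _ _ (bd_nr K X n.+1 \o cone a)
  (idfun \- (cone a \o bd_nr K X n))) => t /=.
rewrite cone_elem !bd_nr_elem big_ord_recl expr0 scale1r face_cons0.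
congr (_ + _); rewrite (linear_sum (cone a)) -sumrN; apply: eq_bigr => i _.
by rewrite face_consS linearZ /= cone_elem exprS mulN1r scaleNr.
Qed.

(** A nonempty elementary path is the cone from its first vertex over the rest. With [bd_nr_cone],
    chain identities follow by induction on the length, without sums over faces. *)
Lemma chain_cone_ind n (W : lmodType K) (f g : {linear chain K X n.+1 -> W}) :
  (forall a t, f (cone a (elem K t)) = g (cone a (elem K t))) -> f =1 g.
Proof.
move=> fg; apply: chain_linear_ext => x.
by rewrite (tuple_eta x) -[elem _ _]cone_elem.
Qed.

Lemma bd_nr_bd_nr n (c : chain K X n.+2) : bd_nr K X n (bd_nr K X n.+1 c) = 0.
Proof.
elim: n => [|n IH] in c *;
  apply: (@chain_cone_ind _ _ (bd_nr K X _ \o bd_nr K X _) \0) => a t /=.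
  by rewrite bd_nr_cone linearB /= bd_nr_cone0 subrr.
by rewrite bd_nr_cone linearB /= bd_nr_cone IH linear0 subr0 subrr.
Qed.

(** The kernel of [reg], that is, the span of the irregular paths. *)
Definition irreg n (c : chain K X n) := reg K X n c == 0.

Lemma irregD n (c d : chain K X n) : irreg c -> irreg d -> irreg (c + d).
Proof. by rewrite /irreg linearD /= => /eqP-> /eqP->; rewrite addr0. Qed.

Lemma irregN n (c : chain K X n) : irreg (- c) = irreg c.
Proof. by rewrite /irreg linearN oppr_eq0. Qed.

Lemma irregB n (c d : chain K X n) : irreg c -> irreg d -> irreg (c - d).
Proof. by move=> ic id; rewrite irregD ?irregN. Qed.

Lemma irreg_elem n (x : n.-tuple X) : ~~ regular_path x -> irreg (elem K x).
Proof. by rewrite /irreg reg_elem => /negPf->. Qed.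

(** A map that sends irregular paths to irregular chains descends to the quotients by irregular
    chains. *)
Lemma irreg_lin n m (Y : finType) (f : {linear chain K X n -> chain K Y m}) :
  (forall x, ~~ regular_path x -> reg K Y m (f (elem K x)) = 0) ->
  forall c, reg K Y m (f (reg K X n c)) = reg K Y m (f c).
Proof.
move=> fI; apply: (@chain_linear_ext _ _ _ _ (reg K Y m \o f \o reg K X n)
  (reg K Y m \o f)) => x /=.
by rewrite reg_elem; case: ifPn => // /fI->; rewrite !linear0.
Qed.

Lemma irreg_cone n a (c : chain K X n) : irreg c -> irreg (cone a c).
Proof.
move=> /eqP ic; apply/eqP; rewrite -(@irreg_lin _ _ _ (cone a)) ?ic ?linear0 //.
move=> x rx /=; rewrite cone_elem reg_elem ifN //; apply: contra rx.
exact: path_sorted.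
Qed.

Lemma irreg_cone_cone n a (c : chain K X n) : irreg (cone a (cone a c)).
Proof.
apply/eqP; apply: (@chain_linear_ext _ _ _ _
  (reg K X _ \o (@cone n.+1 a \o @cone n a)) \0) => y /=.
by rewrite !cone_elem reg_elem /regular_path /= eqxx.
Qed.

(** If the tail has a repetition, the cone formula and induction apply. Otherwise the path is
    [cone a (cone a t)]: the two terms dropping one copy of [a] cancel, and what is left is zero or
    still begins with [a] twice. *)
Lemma bd_nr_irreg_elem n (x : n.+1.-tuple X) : ~~ regular_path x ->
  irreg (bd_nr K X n (elem K x)).
Proof.
elim: n => [|n IH] in x *; case/tupleP: x => a t.
  by rewrite [t]tuple0 /regular_path.
move=> rx; rewrite -[elem _ _]cone_elem bd_nr_cone.
case: (boolP (regular_path t)) => [rt|rt]; last first.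
  by rewrite irregB ?irreg_elem // irreg_cone // IH.
have [t' ->] : exists t' : n.-tuple X, t = [tuple of a :: t'].
  move: rx rt; case/tupleP: t => b t'; rewrite /regular_path /= => /nandP[].
    by rewrite negbK => /eqP -> _; exists t'; apply: val_inj.
  by move=> /negPf->.
rewrite -[elem _ _]cone_elem => {rx rt IH t}.
case: n t' => [|n] t.
  by rewrite bd_nr_cone0 subrr /irreg linear0.
by rewrite bd_nr_cone linearB /= opprB addrCA subrr addr0 irreg_cone_cone.
Qed.

Lemma bd_reg n (c : chain K X n.+1) : bd K X n (reg K X n.+1 c) = bd K X n c.
Proof.
rewrite !comp_lfunE (@irreg_lin _ _ _ (bd_nr K X n)) // => x /bd_nr_irreg_elem.
by move/eqP.
Qed.

Lemma bd_bd n (c : chain K X n.+2) : bd K X n (bd K X n.+1 c) = 0.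
Proof.
by rewrite [bd K X n.+1 c]comp_lfunE bd_reg comp_lfunE bd_nr_bd_nr linear0.
Qed.

End Cone.

(** * Push-forward along vertex maps and the prism homotopy *)

Section Push.
Variables (K : fieldType) (X Y : finType).
Implicit Types f g : X -> Y.

Definition push f n : chain K X n -> chain K Y n :=
  chain_lin (fun t => elem K [tuple of map f t]).
HB.instance Definition _ f n := GRing.Linear.on (@push f n).

Lemma push_elem f n (t : n.-tuple X) :
  push f (elem K t) = elem K [tuple of map f t].
Proof. exact: chain_lin_elem. Qed.

Lemma push_cone f n a (c : chain K X n) :
  push f (cone a c) = cone (f a) (push f c).
Proof.
apply: (@chain_linear_ext _ _ _ _ (@push f n.+1 \o cone a)
  (cone (f a) \o @push f n)) => t /=.
rewrite cone_elem !push_elem cone_elem; congr elem; exact: val_inj.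
Qed.

Lemma bd_nr_push f n (c : chain K X n.+1) :
  bd_nr K Y n (push f c) = push f (bd_nr K X n c).
Proof.
elim: n => [|n IH] in c *;
  apply: (@chain_cone_ind _ _ _ _ (bd_nr K Y _ \o @push f _)
    (@push f _ \o bd_nr K X _)) => a t /=.
  by rewrite push_cone !bd_nr_cone0.
by rewrite push_cone !bd_nr_cone linearB /= push_cone IH.
Qed.

Lemma reg_push_reg f n (c : chain K X n) :
  reg K Y n (push f (reg K X n c)) = reg K Y n (push f c).
Proof.
apply: (@irreg_lin _ _ _ _ _ (@push f n)) => x rx /=.
rewrite push_elem reg_elem ifN //; apply: contra rx.
rewrite /regular_path /= sorted_map; apply: sub_sorted => a b /=.
by move=> nab; apply/eqP => ab; rewrite ab eqxx in nab.
Qed.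

(** [f] may identify consecutive vertices, so the image is regularized, as for [bd]. *)
Definition rpush f n : 'Hom(chain K X n, chain K Y n) :=
  (reg K Y n \o linfun (@push f n))%VF.

Lemma rpushE f n c : rpush f n c = reg K Y n (push f c).
Proof. by rewrite comp_lfunE [linfun _ c]lfunE /=. Qed.

Lemma bd_rpush f n c : bd K Y n (rpush f n.+1 c) = rpush f n (bd K X n c).
Proof.
by rewrite !rpushE bd_reg !comp_lfunE bd_nr_push reg_push_reg.
Qed.

(* Unfolding the recursion, the prism of [x_0, .., x_n] is the sum over i of
   (-1) ^ i [f x_0, .., f x_i, g x_i, .., g x_n]. *)
Fixpoint prism_elem f g n : n.-tuple X -> chain K Y n.+1 :=
  match n with
  | 0 => fun _ => 0
  | n.+1 => fun t =>
      cone (f (thead t)) (cone (g (thead t)) (push g (elem K (behead_tuple t)))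
                          - prism_elem f g (behead_tuple t))
  end.

Definition prism f g n : chain K X n -> chain K Y n.+1 :=
  chain_lin (@prism_elem f g n).
HB.instance Definition _ f g n := GRing.Linear.on (@prism f g n).

Lemma prism0 f g (c : chain K X 0) : prism f g c = 0.
Proof. by rewrite /prism /chain_lin big1 // => x _; rewrite scaler0. Qed.

Lemma prism_cone f g n a (c : chain K X n) :
  prism f g (cone a c) = cone (f a) (cone (g a) (push g c) - prism f g c).
Proof.
apply: (@chain_linear_ext _ _ _ _ (@prism f g n.+1 \o cone a)
  (cone (f a) \o (cone (g a) \o @push g n \- @prism f g n))) => t /=.
rewrite cone_elem /prism !chain_lin_elem /= theadE.
by rewrite (_ : behead_tuple [tuple of a :: t] = t :> n.-tuple X) //;
  apply: val_inj.
Qed.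

(** On a cone, [prism_cone] and [bd_nr_cone] reduce every term to the base; the identity for the
    base, coned from [f a], then cancels the rest. *)
Lemma bd_nr_prism f g n (c : chain K X n.+1) :
  bd_nr K Y n.+1 (prism f g c) + prism f g (bd_nr K X n c) =
  push g c - push f c.
Proof.
elim: n => [|n IH] in c *;
  apply: (@chain_cone_ind _ _ _ _
    ((bd_nr K Y _ \o @prism f g _) \+ (@prism f g _ \o bd_nr K X _))
    (@push g _ \- @push f _)) => a t /=.
  (* The prism vanishes in degree -1, so over a single vertex only the edge from [f a] to [g a]
     remains. *)
  rewrite prism0 addr0 prism_cone prism0 subr0 bd_nr_cone bd_nr_cone0.
  rewrite !push_cone; congr (_ - cone _ _).
  apply: (@chain_linear_ext _ _ _ _ (@push g 0) (@push f 0)) => x /=.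
  by rewrite [x]tuple0 !push_elem; congr elem; apply: val_inj.
rewrite prism_cone !bd_nr_cone !linearB /= !bd_nr_cone prism_cone !push_cone.
rewrite bd_nr_push; set u := elem K t; move: {IH}(IH u).
rewrite -/u; move: (bd_nr K Y _ (prism f g u)) => b /(congr1 (cone (f a))).
rewrite !linearB !linearD /= !opprK => Eb.
rewrite -[in RHS](opprK (cone (f a) (push f u))).
rewrite -(subrK (cone (f a) (push g u)) (- - _)).
rewrite opprK -[_ - cone _ (push g u)]opprB -Eb opprD.
rewrite opprK addrACA subrK; congr (_ + _).
by rewrite [_ + _ + cone _ b]addrAC addrA addrK -addrA addrC.
Qed.

(** The prism of an irregular path is irregular: if the first two vertices agree, each term repeats
    [f a] or [g a], and a repetition further on is handled by induction. *)
Lemma reg_prism_reg f g n (c : chain K X n) :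
  reg K Y n.+1 (prism f g (reg K X n c)) = reg K Y n.+1 (prism f g c).
Proof.
move: c; apply: (@irreg_lin _ _ _ _ _ (@prism f g n)) => x /= rx; apply/eqP.
rewrite -[_ == 0]/(irreg (prism f g (elem K x))).
elim: n => [|n IH] in x rx *; first by rewrite prism0 /irreg linear0.
case/tupleP: x rx => a t; case: n => [|n] in IH t *.
  by rewrite [t]tuple0 /regular_path.
case/tupleP: t => b t rx; rewrite -[elem _ _]cone_elem prism_cone.
case: (boolP (regular_path [tuple of b :: t])) => [rt|rt].
  have <- : a = b.
    by move: rx rt; rewrite /regular_path /= => /nandP[/negPn/eqP//|/negPf->].
  rewrite -[elem _ _]cone_elem push_cone prism_cone linearB /=.
  by rewrite irregB ?irreg_cone_cone // irreg_cone // irreg_cone_cone.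
rewrite irreg_cone // irregB ?IH // irreg_cone // /irreg -reg_push_reg.
by rewrite reg_elem (negPf rt) !linear0.
Qed.

Definition rprism f g n : 'Hom(chain K X n, chain K Y n.+1) :=
  (reg K Y n.+1 \o linfun (@prism f g n))%VF.

Lemma rprismE f g n c : rprism f g n c = reg K Y n.+1 (prism f g c).
Proof. by rewrite comp_lfunE [linfun _ c]lfunE /=. Qed.

Lemma bd_rprism f g n (c : chain K X n.+1) :
  bd K Y n.+1 (rprism f g n.+1 c) + rprism f g n (bd K X n c) =
  rpush g n.+1 c - rpush f n.+1 c.
Proof.
rewrite !rprismE !rpushE bd_reg !comp_lfunE reg_prism_reg -linearB -linearD /=.
by rewrite bd_nr_prism.
Qed.

End Push.

(** * Supports of chains and allowed chains *)

Section AllowedChains.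
Variables (K : fieldType) (X : finType).

Definition supp n (P : pred (n.-tuple X)) (c : chain K X n) :=
  forall x, c x != 0 -> P x.

Lemma supp_lin m n (Y : finType) (F : m.-tuple Y -> chain K X n) P
    (c : chain K Y m) :
  (forall y, c y != 0 -> supp P (F y)) -> supp P (chain_lin F c).
Proof.
move=> sF x; rewrite /chain_lin sum_ffunE => nz; apply/negP => /negP Px.
case/negP: nz; apply/eqP/big1 => y _; rewrite !ffunE.
have [->|cy] := eqVneq (c y) 0; first by rewrite scale0r.
have [->|/(sF _ cy)] := eqVneq (F y x) 0; first by rewrite scaler0.
by rewrite (negPf Px).
Qed.

Lemma supp_elem n (P : pred (n.-tuple X)) x : P x -> supp P (elem K x).
Proof.
by move=> Px y; rewrite elemE; case: (eqVneq y x) => [->|]; rewrite ?eqxx.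
Qed.

Lemma suppB n (P : pred (n.-tuple X)) (c d : chain K X n) :
  supp P c -> supp P d -> supp P (c - d).
Proof.
move=> sc sd x; rewrite !ffunE; have [->|/sc//] := eqVneq (c x) 0.
by rewrite sub0r oppr_eq0 => /sd.
Qed.

Lemma supp_sub n (P Q : pred (n.-tuple X)) (c : chain K X n) :
  subpred P Q -> supp P c -> supp Q c.
Proof. by move=> PQ sc x /sc/PQ. Qed.

Lemma mem_allowed (G : digraph X) n (c : chain K X n) :
  reflect (supp (fun x => sorted (edge G) x) c) (c \in allowed K G n).
Proof.
apply: (iffP idP) => [|sc].
  rewrite /allowed => /coord_span -> x; rewrite sum_ffunE => nz.
  apply/negP => /negP Px; case/negP: nz; apply/eqP/big1 => i _; rewrite !ffunE.
  pose GP := [pred x : n.-tuple X | sorted (edge G) x].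
  have : (image_tuple (fun x => elem K x) GP)`_i \in [seq elem K x | x in GP].
    by apply: mem_nth; rewrite size_image.
  case/fintype.imageP => y Gy ->; rewrite elemE; case: eqVneq => [xy|];
    last by rewrite scaler0.
  by move: Gy; rewrite inE -xy (negPf Px).
rewrite [c]chain_sum_elem; apply: memv_suml => x _.
have [->|/sc Gx] := eqVneq (c x) 0; first by rewrite scale0r mem0v.
by apply/memvZ/memv_span/fintype.image_f.
Qed.

(** The reflexive closure of the edges, since a vertex map may collapse an edge; regularizing kills
    the paths where this happens. *)
Definition weak_edge (G : digraph X) : rel X :=
  fun a b => (a == b) || edge G a b.

Lemma reg_allowed (G : digraph X) n (c : chain K X n) :
  supp (fun x => sorted (weak_edge G) x) c -> reg K X n c \in allowed K G n.
Proof.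
move=> sc; apply/mem_allowed => x; rewrite lfunE /= ffunE.
case: ifP => [rx /sc|]; last by rewrite eqxx.
move: rx; rewrite /regular_path; case: (tval x) => //= a s.
elim: s a => //= b s IH a /andP[/negPf ab rs] /andP[+ ws].
by rewrite /weak_edge ab /= => -> /=; apply: IH.
Qed.

Lemma allowed_regular (G : digraph X) n c :
  c \in allowed K G n -> reg K X n c = c.
Proof.
move=> /mem_allowed sc; apply/ffunP => x; rewrite lfunE /= ffunE.
case: ifPn => // rx; apply/eqP; rewrite eq_sym; apply/negPn/negP => /sc.
move=> Gx; case/negP: rx; apply: sub_sorted Gx => a b; apply: contraTneq => ->.
by rewrite edge_irr.
Qed.

End AllowedChains.

(** * Digraph maps and their homotopies on cycles and boundaries *)

Section DigraphMaps.
Variables (K : fieldType) (X Y : finType) (G : digraph X) (H : digraph Y).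

Definition digraph_map (f : X -> Y) :=
  forall a b, edge G a b -> weak_edge H (f a) (f b).

Lemma push_allowed f n c : digraph_map f ->
  c \in allowed K G n -> rpush K f n c \in allowed K H n.
Proof.
move=> hf /mem_allowed sc; rewrite rpushE; apply: reg_allowed.
apply: supp_lin => y /sc sy; apply: supp_elem.
by rewrite /= sorted_map; apply: sub_sorted sy => a b; apply: hf.
Qed.

Lemma rpush_Omega f p c : digraph_map f ->
  c \in Omega K G p -> rpush K f p.+1 c \in Omega K H p.
Proof.
move=> hf; rewrite !memv_cap -!memv_preim => /andP[cG bG].
by rewrite push_allowed // bd_rpush push_allowed.
Qed.

Lemma rpush_cycles f p c : digraph_map f ->
  c \in cycles K G p -> rpush K f p.+1 c \in cycles K H p.
Proof.
move=> hf; rewrite !(memv_cap _ (Omega _ _ _)) !memv_ker => /andP[cO /eqP bc].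
by rewrite rpush_Omega // bd_rpush bc linear0 eqxx.
Qed.

Lemma rpush_boundaries f p c : digraph_map f ->
  c \in boundaries K G p -> rpush K f p.+1 c \in boundaries K H p.
Proof.
move=> hf /memv_imgP[b bO ->]; rewrite -bd_rpush.
by apply/memv_img/rpush_Omega.
Qed.

Variables f g : X -> Y.
Hypotheses (hf : digraph_map f) (hg : digraph_map g)
  (fg : forall a, weak_edge H (f a) (g a)).

Lemma supp_cone a b n (c : chain K Y n) : weak_edge H b a ->
  supp (fun y => path (weak_edge H) a y) c ->
  supp (fun y => path (weak_edge H) b y) (cone a c).
Proof.
move=> ba sc; apply: supp_lin => y /sc sy; apply: supp_elem.
by rewrite /= ba.
Qed.

(** Each path runs through [f x_0], ..., [f x_i], [g x_i], ..., [g x_n], so its steps are weak edges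
    by [hf], [fg] or [hg]. The preceding vertex [b] lets the induction prepend vertices. *)
Lemma prism_elem_path n (x : n.-tuple X) b :
  sorted (edge G) x ->
  (forall a s, x = a :: s :> seq X -> weak_edge H b (f a)) ->
  supp (fun y => path (weak_edge H) b y) (prism_elem K f g x).
Proof.
elim: n => [|n IH] in x b *; first by move=> _ _ y; rewrite ffunE eqxx.
case/tupleP: x => a t Gx /(_ a t erefl) bfa.
rewrite /= theadE (_ : behead_tuple [tuple of a :: t] = t :> n.-tuple X);
  last exact: val_inj.
apply: supp_cone => //; apply: suppB.
  apply: supp_cone => //; rewrite push_elem; apply: supp_elem.
  by rewrite /= path_map; apply: sub_path Gx => c d; apply: hg.
apply: IH; first exact: path_sorted Gx.
by move=> c s ts; apply: hf; move: Gx; rewrite /= ts /= => /andP[].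
Qed.

Lemma rprism_allowed n c :
  c \in allowed K G n -> rprism K f g n c \in allowed K H n.+1.
Proof.
move=> /mem_allowed sc; rewrite rprismE; apply: reg_allowed.
apply: supp_lin => x /sc Gx; case: n => [|n] in c sc x Gx *.
  by move=> y; rewrite ffunE eqxx.
apply: (@supp_sub _ _ _ (fun y => path (weak_edge H) (f (thead x)) y)).
  by move=> y /path_sorted.
apply: prism_elem_path => // a s xas;
  rewrite (_ : thead x = a) ?/weak_edge ?eqxx //.
by rewrite /thead (tnth_nth a) xas.
Qed.

(** The prism of [c] is allowed and, as [c] is a cycle, its boundary is a difference of two allowed
    push-forwards. So the prism lies in [Omega] and bounds that difference. *)
Lemma homotopic_cycles p c : c \in cycles K G p ->
  rpush K g p.+1 c - rpush K f p.+1 c \in boundaries K H p.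
Proof.
move=> cZ; move: (cZ); rewrite !(memv_cap, memv_ker) -!memv_preim.
move=> /andP[/andP[cG bG] /eqP bc].
rewrite -bd_rprism bc linear0 addr0 memv_img // memv_cap -memv_preim.
rewrite rprism_allowed //=.
have := bd_rprism f g c; rewrite bc linear0 addr0 => ->.
by rewrite memvB ?push_allowed.
Qed.

End DigraphMaps.

Section PushFunctor.
Variables (K : fieldType) (X Y Z : finType).

Lemma rpush_id n c : rpush K (@id X) n c = reg K X n c.
Proof.
rewrite rpushE; congr (reg _ _ _ _).
apply: (@chain_linear_ext _ _ _ _ (@push K X X id n) idfun) => t /=.
by rewrite push_elem; congr elem; apply: val_inj; rewrite /= map_id.
Qed.

Lemma rpush_comp (f : X -> Y) (g : Y -> Z) n c :
  rpush K g n (rpush K f n c) = rpush K (g \o f) n c.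
Proof.
rewrite !rpushE reg_push_reg; congr (reg _ _ _ _).
apply: (@chain_linear_ext _ _ _ _ (@push K Y Z g n \o @push K X Y f n)
  (@push K X Z (g \o f) n)) => t /=.
by rewrite !push_elem; congr elem; apply: val_inj; rewrite /= -map_comp.
Qed.

Lemma cycles_regular (G : digraph X) p c :
  c \in cycles K G p -> reg K X p.+1 c = c.
Proof. by rewrite !memv_cap => /andP[/andP[/allowed_regular]]. Qed.

Lemma boundaries_sub_cycles (G : digraph X) p :
  (boundaries K G p <= cycles K G p)%VS.
Proof.
apply/subvP => _ /memv_imgP[b + ->]; rewrite !(memv_cap, memv_ker) -!memv_preim.
by rewrite bd_bd eqxx mem0v => /andP[_ ->].
Qed.

End PushFunctor.

(** * Adapted bases of two flags *)

Section TwoFlags.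
Variables (K : fieldType) (V : vectType K).
Implicit Types (E F : seq V) (W B Z : {vspace V}).

Definition adapted E W := (<<E>> :&: W <= <<[seq x <- E | x \in W]>>)%VS.

(** [F] is a basis of a complement of [<<E>> :&: W] in [W]. A space [W'] stays adapted if it meets
    [B] only within [<<E>>], for then it gains nothing, or if it contains [W], for then it contains
    all of [F]. *)
Lemma adapted_extend B W E : (W <= B)%VS -> free E -> (<<E>> <= B)%VS ->
  exists F, [/\ free (E ++ F), (<<E ++ F>> <= B)%VS, (W <= <<E ++ F>>)%VS &
    forall W', adapted E W' -> (W' :&: B <= <<E>>)%VS \/ (W <= W')%VS ->
      adapted (E ++ F) W'].
Proof.
move=> WB fE EB; set F := vbasis (W :\: <<E>>)%VS.
have spF : <<F>>%VS = (W :\: <<E>>)%VS by exact: span_basis (vbasisP _).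
have FW : (<<F>> <= W)%VS by rewrite spF diffvSl.
exists F; split.
- rewrite cat_free fE (basis_free (vbasisP _)) /=; apply/directv_addP.
  by rewrite spF capvC capv_diff.
- by rewrite span_cat subv_add EB (subv_trans FW).
- by rewrite span_cat spF addvC addv_diff addvSl.
move=> W' aE [W'E|WW']; apply/subvP => x /memv_capP[].
  have EFB : (<<E ++ F>> <= B)%VS by rewrite span_cat subv_add EB (subv_trans FW).
  move=> xEF xW'; have xE : x \in <<E>>%VS.
    by rewrite (subvP W'E) // memv_cap xW' (subvP EFB).
  rewrite filter_cat span_cat (subvP (addvSl _ _)) //.
  by rewrite (subvP aE) // memv_cap xE.
rewrite span_cat => /memv_addP[e eE [f fF ->]] efW'.
have fW' : f \in W' by rewrite (subvP WW') // (subvP FW).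
have eW' : e \in W' by rewrite -(addrK f e) rpredB.
rewrite filter_cat span_cat memv_add //;
  first by rewrite (subvP aE) // memv_cap eE.
rewrite (_ : [seq x <- F | x \in W'] = F) //; apply/all_filterP/allP => y yF.
by rewrite (subvP WW') // (subvP FW) // memv_span.
Qed.

(** The members of [Zs] are used in increasing order, each extending the list to cover its
    intersection with [B]. At any stage a member already treated meets [B] within the span, and any
    other contains the space being covered: these are the two cases of [adapted_extend]. *)
Lemma adapted_extend_flag B Zs E : sorted (fun U W => U <= W)%VS Zs ->
  free E -> (<<E>> <= B)%VS ->
  exists F, [/\ free (E ++ F), (<<E ++ F>> <= B)%VS,
    {in Zs, forall Z, (Z :&: B <= <<E ++ F>>)%VS} &
    forall W', adapted E W' ->
      [\/ (W' :&: B <= <<E>>)%VS, {in Zs, forall Z, (Z :&: B <= W')%VS} |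
        W' \in Zs] ->
      adapted (E ++ F) W'].
Proof.
have tr : transitive (fun U W : {vspace V} => U <= W)%VS by exact: subv_trans.
move=> sZ fE EB; elim/last_ind: Zs sZ => [|Zs Z IH] sZ.
  by exists nil; rewrite cats0; split.
have sZ' : sorted (fun U W => U <= W)%VS Zs.
  by move: sZ; rewrite -cats1 => /cat_sorted2[].
have leZ Z' : Z' \in Zs -> (Z' <= Z)%VS.
  by move: sZ;
    rewrite (sorted_pairwise tr) pairwise_rcons => /andP[/allP h _] /h.
have [F [fF FB covF aF]] := IH sZ'.
have [F' [fF' F'B covF' aF']] := adapted_extend (capvSr Z B) fF FB.
exists (F ++ F'); rewrite catA; split=> //.
- move=> Z'; rewrite mem_rcons inE => /predU1P[->//|/covF cZ'].
  by rewrite (subv_trans cZ') // [X in (_ <= X)%VS]span_cat addvSl.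
move=> W' aW' hW'; apply: aF'.
  apply: aF => //; case: hW' => [|BW|]; first by constructor 1.
    by constructor 2 => Z' Z'Zs; apply: BW; rewrite mem_rcons inE Z'Zs orbT.
  rewrite mem_rcons inE => /predU1P[->|]; last by constructor 3.
  by constructor 2 => Z' /leZ; apply/subv_trans/capvSl.
case: hW' => [W'E|BW|]; first by left;
  rewrite (subv_trans W'E) // span_cat addvSl.
  by right; apply: BW; rewrite mem_rcons mem_head.
rewrite mem_rcons inE => /predU1P[->|/covF]; last by left.
by right; rewrite capvSl.
Qed.

(** The members of [Bs] are filled in increasing order, each along its intersections with the
    members of [Zs]; since [fullv] is among these, each is filled completely. *)
Lemma two_flags Zs Bs : sorted (fun U W => U <= W)%VS Zs ->
  sorted (fun U W => U <= W)%VS Bs -> fullv \in Zs ->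
  exists E, [/\ free E, {in Bs, forall B, (B <= <<E>>)%VS} &
    {in Zs ++ Bs, forall W, adapted E W}].
Proof.
have tr : transitive (fun U W : {vspace V} => U <= W)%VS by exact: subv_trans.
move=> sZ sB fullZ.
(* The extra clause keeps [<<E>>] below the last member of [Bs], in a form that also covers the
   empty list. *)
suff [E [fE covE aE _]] : exists E,
    [/\ free E, {in Bs, forall B, (B <= <<E>>)%VS},
    {in Zs ++ Bs, forall W, adapted E W} &
    forall U, {in Bs, forall B, (B <= U)%VS} -> (<<E>> <= U)%VS].
  by exists E; split.
elim/last_ind: Bs sB => [|Bs B IH] sB.
  exists nil; split=> [|//|W _|U _]; rewrite ?nil_free ?span_nil ?sub0v //.
  by rewrite /adapted span_nil cap0v sub0v.
have sB' : sorted (fun U W => U <= W)%VS Bs.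
  by move: sB; rewrite -cats1 => /cat_sorted2[].
have leB B' : B' \in Bs -> (B' <= B)%VS.
  by move: sB;
    rewrite (sorted_pairwise tr) pairwise_rcons => /andP[/allP h _] /h.
have [E [fE covE aE ubE]] := IH sB'.
have EB := ubE B leB.
have [F [fF FB covF aF]] := adapted_extend_flag sZ fE EB.
have BF : (B <= <<E ++ F>>)%VS by have := covF _ fullZ; rewrite capfv.
exists (E ++ F); split=> //.
- move=> B'; rewrite mem_rcons inE => /predU1P[->//|/leB h].
  exact: subv_trans BF.
- move=> W; rewrite -cats1 catA mem_cat inE => /orP[WZB|/eqP->].
    apply: aF; first exact: aE.
    move: WZB; rewrite mem_cat => /orP[|WB]; first by constructor 3.
    by constructor 1; rewrite (subv_trans (capvSl _ _)) // covE.
  apply: aF; last by constructor 2 => Z _; rewrite capvSr.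
  rewrite /adapted (subv_trans (capvSl _ _)) //.
  rewrite (_ : [seq x <- E | x \in B] = E) //.
  apply/all_filterP/allP => y yE; by rewrite (subvP EB) // memv_span.
by move=> U hU; rewrite (subv_trans FB) // hU // mem_rcons mem_head.
Qed.

End TwoFlags.

(** * Barcodes of subquotients *)

Lemma inj_surj_bij (T U : Type) (f : T -> U) :
  injective f -> (forall y, exists x, f x = y) -> bijective f.
Proof.
move=> fI /choice[g gK]; exists g => // x; exact: fI.
Qed.

(** The elements of [seq_mset s] come in an unspecified order; this transports that order from bars
    back to basis vectors. *)
Lemma perm_map_eq (S T : eqType) (f : S -> T) (s : seq S) (t : seq T) :
  perm_eq t (map f s) -> exists2 s', perm_eq s' s & t = map f s'.
Proof.
case: s => [|x0 s0]; first by move=> /perm_nilP->; exists nil.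
move: (x0 :: s0) => s /(perm_iotaP (f x0))[Is pI ->].
exists [seq nth x0 s i | i <- Is].
  by apply/(perm_iotaP x0); exists Is; rewrite // -(size_map f).
rewrite -map_comp; apply/eq_in_map => i iI.
rewrite (nth_map x0) //.
by move: iI; rewrite (perm_mem pI) mem_iota size_map.
Qed.

Definition linear_pack (K : fieldType) (U V : lmodType K) (f : U -> V)
    (fL : linear f) : {linear U -> V} :=
  HB.pack f (GRing.isLinear.Build _ _ _ _ _ fL).

Section PersistenceIso.
Variables (K : fieldType) (R : realType).
Implicit Types V W U : persvect K R.

Lemma pv_iso_sym V W : pv_iso V W -> pv_iso W V.
Proof.
case=> phi [phi_bij phi_nat].
have [psi psiP] : exists psi : forall t, W t -> V t,
    forall t, cancel (phi t) (psi t) /\ cancel (psi t) (phi t).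
  have ex t : exists g, cancel (phi t) g /\ cancel g (phi t).
    by have [g h1 h2] := phi_bij t; exists g.
  by exists (fun t => projT1 (cid (ex t))) => t; case: (cid _).
have psi_lin t : linear (psi t).
  have [k1 k2] := psiP t => a u v.
  by apply: (can_inj k1); rewrite linearP !k2.
exists (fun t => linear_pack (psi_lin t)).
split=> [t|s t h v] /=; first by have [k1 k2] := psiP t; exists (phi t).
have [k1 k2] := psiP t; have [_ k2s] := psiP s.
by apply: (can_inj k1); rewrite phi_nat k2 k2s.
Qed.

Lemma pv_iso_trans V W U : pv_iso V W -> pv_iso W U -> pv_iso V U.
Proof.
case=> phi [phib phin] [psi [psib psin]].
exists (fun t => [the {linear _ -> _} of psi t \o phi t]).
by split=> [t|s t h v] /=;
  [exact: (bij_comp (psib t) (phib t)) | rewrite phin psin].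
Qed.

End PersistenceIso.

Section SubquotientModules.
Variables (K : fieldType) (R : realType) (V : vectType K).
Variables (Z B : {nonneg R} -> {vspace V}).
Hypotheses (sZ : forall s t, s <= t -> (Z s <= Z t)%VS)
  (sB : forall s t, s <= t -> (B s <= B t)%VS).

Definition sq_map s t (h : s <= t) :
  {linear subquot (Z s) (B s) -> subquot (Z t) (B t)} :=
  subquot_map (sZ h) (sB h).

Fact sq_map_id s (h : s <= s) v : sq_map h v = v.
Proof. by rewrite -[v]repr_sqK [LHS]subquot_map_pi ?vsvalK // (sZ, sB). Qed.

Fact sq_map_comp s t u (hst : s <= t) (htu : t <= u) (hsu : s <= u) v :
  sq_map htu (sq_map hst v) = sq_map hsu v.
Proof.
rewrite -[v]repr_sqK [sq_map hst _]subquot_map_pi ?(sZ, sB) //.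
rewrite [LHS]subquot_map_pi ?(sZ, sB) // [RHS]subquot_map_pi ?(sZ, sB) //.
by rewrite vsprojK // (subvP (sZ hst)) ?subvsP.
Qed.

Definition sq_pers : persvect K R := PersVect sq_map_id sq_map_comp.

Section Barcode.
Variables (E : seq V) (birth death : V -> \bar R).
Hypotheses (freeE : free E) (sBZ : forall t, (B t <= Z t)%VS)
  (birth_ge0 : {in E, forall e, (0 <= birth e)%E})
  (birthP : {in E, forall e t, (e \in Z t) = (birth e <= t%:num%:E)%E})
  (deathP : {in E, forall e t, (e \in B t) = (death e <= t%:num%:E)%E})
  (spanZ : forall t, (Z t <= <<[seq e <- E | e \in Z t]>>)%VS)
  (spanB : forall t, (B t <= <<[seq e <- E | e \in B t]>>)%VS).

Let pt e : dgm_pt R := (birth e, death e).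
(** A vector for which [birth e < death e] fails is never a cycle without being a boundary, so it
    gives no bar. *)
Definition barcode_of_basis : multiset (dgm_pt R) :=
  seq_mset [seq pt e | e <- E & (birth e < death e)%E].
Let D := barcode_of_basis.

(** The vectors of [E] in [Z t] but not in [B t] are those whose bars are alive at [t]. They
    represent a basis of the quotient, and the structure maps carry each class to itself until it
    bounds. *)
Lemma sq_barcode : is_barcode sq_pers D.
Proof.
split=> [u|].
  rewrite -has_pred1 (perm_has _ (perm_eq_seq_mset _)) has_pred1.
  by case/mapP => e; rewrite mem_filter => /andP[bd eE] ->; split;
    rewrite ?birth_ge0.
(* [E'] lists the vectors that have a bar, in the order in which [D] lists the bars. *)
have [E' permE' DE] := perm_map_eq (perm_eq_seq_mset
  [seq pt e | e <- E & (birth e < death e)%E]).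
have memE' e : (e \in E') = (birth e < death e)%E && (e \in E).
  by rewrite (perm_mem permE') mem_filter.
have freeE' : free E' by rewrite (perm_free permE') filter_free.
have szE' : size D = size E' by rewrite /D /barcode_of_basis DE size_map.
have nthD k : (k < size D)%N -> nth (pt 0) D k = pt E'`_k.
  by rewrite szE' /D /barcode_of_basis DE => kE'; rewrite (nth_map 0).
have barE (i : 'I_(size D)) : bar i = pt E'`_i.
  by rewrite /bar (tnth_nth (pt 0)) nthD.
have memE'i (i : 'I_(size D)) : E'`_i \in E.
  have := mem_nth 0 (_ : (i < size E')%N); rewrite memE' -szE'.
  by move=> /(_ (ltn_ord i)) /andP[].
pose cf t (f : interval_sum_sp K D t) (i : 'I_(size D)) : K := oapp f 0 (insub i).
pose S t f : V := \sum_i cf t f i *: E'`_i.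
have S_lin t : linear (S t).
  move=> a u v; rewrite /S scaler_sumr -big_split /=; apply: eq_bigr => i _.
  rewrite scalerA -scalerDl; congr (_ *: _); rewrite /cf.
  by case: insubP => [j _ _|_] /=; rewrite ?ffunE // mulr0 addr0.
have S_Z t f : S t f \in Z t.
  apply: memv_suml => i _; rewrite /cf; case: insubP => [j ai _|_] /=;
    last by rewrite scale0r mem0v.
  by apply: memvZ; rewrite birthP //; move: ai; rewrite barE => /andP[].
pose phi t (f : interval_sum_sp K D t) : subquot (Z t) (B t) :=
  pi_sq (B t) (vsproj (Z t) (S t f)).
have phi_lin t : linear (phi t).
  by move=> a u v; rewrite /phi S_lin !linearP.
(* The isomorphism is built from bars to classes: a bar goes to the class of its vector. *)
apply: pv_iso_sym.
exists (fun t => linear_pack (phi_lin t)).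
(* [At t] is a basis of a complement of [B t] in [Z t], and [Bt t] a basis of [B t]. *)
pose At t := [seq e <- E' | alive (pt e) t].
pose Bt t := [seq e <- E | e \in B t].
have freeAB t : free (At t ++ Bt t).
  pose AB := [seq e <- E | (e \in At t) || (e \in Bt t)].
  rewrite (@perm_free _ _ _ AB) ?filter_free //.
  apply: uniq_perm.
  - rewrite cat_uniq !filter_uniq ?free_uniq // andbT.
    apply/hasPn => e; rewrite !mem_filter => /andP[eB eE].
    apply/negP => /andP[/andP[_ /=]]; rewrite ltNge.
    by rewrite -(deathP eE) eB.
  - by rewrite filter_uniq ?free_uniq.
  move=> e; rewrite mem_cat !mem_filter memE'.
  by case: (e \in E); rewrite ?andbF ?andbT ?orbF.
split=> [t|s t h f] /=; last first.
  rewrite /phi [RHS]subquot_map_pi; [|exact: sZ|exact: sB].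
  apply/pi_sqP; rewrite !vsprojK // ?(subvP (sZ h)) ?S_Z //.
  (* The two representatives differ by terms whose bars have died by [t], and these vectors lie in
     [B t]. *)
  rewrite /S -sumrB; apply: memv_suml => i _; rewrite -scalerBl /cf.
  case: insubP => [j ait ji|nait] /=.
    by rewrite ffunE ji subrr scale0r mem0v.
  case: insubP => [j ais ji|nais] /=; last by rewrite subrr scale0r mem0v.
  apply: memvZ; rewrite deathP //; move: ais nait;
    rewrite barE => /andP[/= bs sd].
  by rewrite /alive /= (le_trans bs) ?lee_fin //= -leNgt.
apply: inj_surj_bij.
  have inj0 f : phi t f = 0 -> f = 0.
    have <- : pi_sq (B t) (0 : subvs_of (Z t)) = 0 by exact: linear0.
    move=> /pi_sqP; rewrite [vsval 0]linear0 subr0 vsprojK // => SB.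
    have : S t f \in (<<At t>> :&: <<Bt t>>)%VS.
      rewrite memv_cap (subvP (spanB t)) // andbT.
      apply: memv_suml => i _; rewrite /cf; case: insubP => [j ai _|_] /=;
        last by rewrite scale0r mem0v.
      apply/memvZ/memv_span;
        rewrite mem_filter -barE ai mem_nth // -szE' ltn_ord //.
    have := freeAB t; rewrite cat_free => /and3P[_ _ /directv_addP->].
    rewrite memv0 => /eqP S0; apply/ffunP => j; rewrite ffunE.
    have sz : size E' == size D by rewrite szE'.
    have /freeP := freeE' : free (Tuple sz).
    move=> /(_ (cf t f) S0 (val j)); by rewrite /cf valK.
  move=> f g fg; apply/eqP; rewrite -subr_eq0; apply/eqP/inj0.
  by have := linearB (linear_pack (phi_lin t)) f g; rewrite /= fg subrr.
(* Surjectivity: the [Bt t] part of a representative vanishes in the quotient, and the [At t] part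
   is reached by [S t]. *)
move=> q; rewrite -[q]repr_sqK; set z := repr q.
have : vsval z \in (<<At t>> + <<Bt t>>)%VS.
  have /(subvP (spanZ t)) := subvsP z.
  apply/subvP; rewrite -span_cat; apply: sub_span => e.
  rewrite mem_cat !mem_filter memE' => /andP[eZ eE]; rewrite eE !andbT.
  case: (boolP (e \in B t)) => eB; rewrite ?orbT //= orbF.
  by move: eZ eB; rewrite birthP // deathP // -ltNge /alive /= => be td;
    rewrite be td (le_lt_trans be).
case/memv_addP => a aA [b bB zab].
have spB : (<<Bt t>> <= B t)%VS.
  by apply/span_subvP => e; rewrite mem_filter => /andP[].
have [f Sf] : exists f, S t f = a.
  pose fspace := {ffun {i : 'I_(size D) | alive (bar i) t} -> K^o}.
  have : a \in limg (linfun (linear_pack (S_lin t) : {linear fspace -> V})).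
    apply: (subvP _ _ aA); apply/span_subvP => e;
      rewrite mem_filter => /andP[et eE'].
    have iD : (index e E' < size D)%N by rewrite szE' index_mem.
    have ai : alive (bar (Ordinal iD)) t by rewrite barE /= nth_index.
    pose j : {i : 'I_(size D) | alive (bar i) t} := Sub (Ordinal iD) ai.
    apply/memv_imgP; exists [ffun k => (k == j)%:R]; rewrite ?memvf // lfunE /=.
    rewrite /S (bigD1 (Ordinal iD)) //= nth_index // big1 ?addr0.
      rewrite /cf; case: insubP => [k _ kE|]; last by rewrite ai.
      by rewrite /= ffunE -val_eqE /= kE eqxx scale1r.
    move=> i ij; rewrite /cf; case: insubP => [k _ ki|_] /=;
      last by rewrite scale0r.
    rewrite ffunE (_ : (k == j) = false) ?scale0r //; apply/negP => /eqP kj.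
    by rewrite -ki kj eqxx in ij.
  by case/memv_imgP => f _ ->; exists f; rewrite lfunE.
exists f; apply/pi_sqP; rewrite vsprojK // Sf zab opprD addrA subrr sub0r memvN.
exact: subvP spB _ bB.
Qed.
End Barcode.
End SubquotientModules.

(** * Uniqueness of barcodes *)

Section Uniqueness.
Variables (K : fieldType) (R : realType).
Implicit Types D : seq (dgm_pt R).

Definition interval_map D s t :
  'Hom({ffun {i : 'I_(size D) | alive (bar i) s} -> K^o},
    {ffun {i : 'I_(size D) | alive (bar i) t} -> K^o}) :=
  linfun (@interval_sum_fun K R D s t).

(** The map factors through the coordinates [J] of the bars alive at both scales: restriction [h] to
    [J] is onto and extension by zero [g] is injective, so the rank is the size of [J]. *)
Lemma rank_interval_sum D s t : \dim (limg (interval_map D s t)) =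
  count (fun u => alive u s && alive u t) D.
Proof.
pose J := ({i : 'I_(size D) | alive (bar i) s && alive (bar i) t})%type.
pose h (f : {ffun {i : 'I_(size D) | alive (bar i) s} -> K^o}) :
    {ffun J -> K^o} :=
  [ffun j => oapp f 0 (insub (val j))].
pose g (f : {ffun J -> K^o}) :
    {ffun {i : 'I_(size D) | alive (bar i) t} -> K^o} :=
  [ffun j => oapp f 0 (insub (val j))].
have hL : linear h.
  move=> a u v; apply/ffunP => j; rewrite !ffunE.
  by case: insubP => [i _ _|_] /=; rewrite ?ffunE // scaler0 addr0.
have gL : linear g.
  move=> a u v; apply/ffunP => j; rewrite !ffunE.
  by case: insubP => [i _ _|_] /=; rewrite ?ffunE // scaler0 addr0.
have -> : interval_map D s t =
    (linfun (linear_pack gL) \o linfun (linear_pack hL))%VF.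
  apply/lfunP => f; rewrite comp_lfunE !lfunE /=; apply/ffunP => j;
    rewrite !ffunE.
  case: (insubP _ (val j)) => [i ai ij|ai] /=.
    case: insubP => [k _ kj|] /=; last by rewrite ai (valP j).
    by rewrite ffunE kj -ij valK.
  by case: insubP => [k /andP[ak _] kj|] //=; rewrite ak in ai.
rewrite limg_comp.
have -> : limg (linfun (linear_pack hL)) = fullv.
  apply/eqP; rewrite eqEsubv subvf; apply/subvP => f _.
  apply/memv_imgP; exists [ffun j => oapp f 0 (insub (val j))];
    rewrite ?memvf // lfunE /=.
  apply/ffunP => j; rewrite ffunE; case: insubP => [k _ kj|] /=;
    last by case/andP: (valP j) => ->.
  by rewrite ffunE kj valK.
rewrite limg_dim_eq; last first.
  rewrite capfv; apply/eqP/lker0P => f f'; rewrite !lfunE => /ffunP gf.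
  apply/ffunP => j; have /andP[js jt] := valP j.
  have := gf (Sub (val j) jt); rewrite !ffunE /=.
  by case: insubP => [k _ /val_inj->|] //=; rewrite js jt.
rewrite dimvf (_ : dim _ = (#|{: J}| * 1)%N) // muln1 card_sig.
rewrite -sum1_card -sum1_count (big_nth (0%E, 0%E)) big_mkord.
by apply: eq_bigl => i; rewrite inE /bar (tnth_nth (0%E, 0%E)).
Qed.

Lemma pv_iso_rank D D' : pv_iso (interval_sum K D) (interval_sum K D') ->
  forall s t : {nonneg R}, s <= t ->
  count (fun u => alive u s && alive u t) D =
  count (fun u => alive u s && alive u t) D'.
Proof.
case=> phi [phib phin] s t st; rewrite -!rank_interval_sum.
pose f r : 'Hom({ffun {i : 'I_(size D) | alive (bar i) r} -> K^o},
    {ffun {i : 'I_(size D') | alive (bar i) r} -> K^o}) := linfun (phi r).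
have fE : (f t \o interval_map D s t = interval_map D' s t \o f s)%VF.
  by apply/lfunP => v; rewrite !comp_lfunE !lfunE; exact: phin st v.
have f0 r : lker (f r) == 0%VS.
  by have /bij_inj inj := phib r; apply/lker0P => u v; rewrite !lfunE => /inj.
have fs : limg (f s) = fullv.
  apply/eqP; rewrite eqEsubv subvf; apply/subvP => v _.
  have [g _ gK] := phib s; apply/memv_imgP; exists (g v);
    rewrite ?memvf // lfunE.
  by rewrite /= gK.
rewrite -(@limg_dim_eq _ _ _ (f t)); last by rewrite (eqP (f0 t)) capv0.
by rewrite -limg_comp fE limg_comp fs.
Qed.

(* A bar coming first for this order in one of two multisets with the same ranks
   belongs to the other one as well. *)
Definition longer (u v : dgm_pt R) :=
  ((u.1 < v.1) || (u.1 == v.1) && (v.2 <= u.2))%E.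

Lemma longer_total : total longer.
Proof.
by move=> u v; rewrite /longer; case: ltgtP => //= _; rewrite orbC le_total.
Qed.

Lemma longer_trans : transitive longer.
Proof.
move=> v u w; rewrite /longer.
move=> /orP[uv|/andP[/eqP-> vu]] /orP[vw|/andP[/eqP<- wv]].
- by rewrite (lt_trans uv).
- by rewrite uv.
- by rewrite vw.
by rewrite eqxx (le_trans wv) ?orbT.
Qed.

Definition bars D := {in D, forall u, (0 <= u.1)%E /\ (u.1 < u.2)%E}.

Lemma longest_mem D D' m : m \in D -> bars D -> bars D' ->
  {in D', forall v, longer m v} ->
  (forall s t : {nonneg R}, s <= t ->
    count (fun u => alive u s && alive u t) D =
    count (fun u => alive u s && alive u t) D') ->
  m \in D'.
Proof.
move=> mD bD bD' mlong rk.
have [m1 m12] := bD _ mD.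
apply/negPn/negP => nm.
(* [x] is the latest death in [D'] among bars born at [m.1], or [m.1] if there are none. If [m] is
   missing from [D'], all of these die strictly before [m] does. *)
pose x : \bar R := \big[maxe/m.1]_(v <- D' | v.1 == m.1) v.2.
have xm : (x < m.2)%E.
  rewrite /x big_seq_cond;
    elim/big_ind: _ => // [a b am bm|v /andP[vD' /eqP vm]].
    by rewrite gt_max am.
  have := mlong _ vD';
    rewrite /longer vm ltxx eqxx /= le_eqVlt => /orP[/eqP v2|//].
  by case/negP: nm;
    rewrite (_ : m = v) // [v]surjective_pairing vm v2 -surjective_pairing.
have mx : (m.1 <= x)%E by exact: bigmax_ge_id.
have fin y : (m.1 <= y)%E -> (y < m.2)%E ->
    exists t : {nonneg R}, t%:num%:E = y.
  case: y => [r| |] h1 h2.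
  - have r0 : 0 <= r by rewrite -lee_fin (le_trans m1).
    by exists (NngNum r0).
  - by move: h2; rewrite ltNge leey.
  - by have := le_trans m1 h1.
have [s sE] := fin _ (lexx _) m12.
have [t tE] := fin _ mx xm.
have st : s <= t by rewrite -num_le -lee_fin sE tE.
(* [m] is alive at both [m.1] and [x], hence so is some bar of [D']. By [mlong] that bar is born at
   [m.1], yet it dies after [x], a contradiction. *)
have : (0 < count (fun u => alive u s && alive u t) D)%N.
  by rewrite -has_count; apply/hasP; exists m => //;
    rewrite /alive sE tE lexx m12 mx xm.
rewrite rk // -has_count => /hasP[v vD' /andP[/andP[v1 _] /andP[_ v2]]].
have v1m : v.1 = m.1.
  have := mlong _ vD'; rewrite /longer; rewrite -sE in v1 *.
  by rewrite ltNge v1 /= => /andP[/eqP].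
move: v2; rewrite tE ltNge => /negP; apply.
by apply: (@le_bigmax_seq _ _ _ _ _ v); rewrite ?v1m.
Qed.

(** The first bar of both lists together for [longer] occurs in each; removing it lowers all counts
    equally, and induction on the total size applies. *)
Lemma rank_perm_eq D D' : bars D -> bars D' ->
  (forall s t : {nonneg R}, s <= t ->
    count (fun u => alive u s && alive u t) D =
    count (fun u => alive u s && alive u t) D') ->
  perm_eq D D'.
Proof.
have [n] := ubnP (size D + size D'); elim: n => // n IH in D D' *.
move=> szD bD bD' rk.
have [/nilP|] := boolP (nilp (D ++ D')).
  by move=> /(congr1 size)/eqP;
    rewrite size_cat addn_eq0 => /andP[/nilP-> /nilP->].
case sDD: (sort longer (D ++ D')) => [|m L] nz.
  by move: nz; rewrite /nilp -(size_sort longer) sDD.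
have mmin : {in D ++ D', forall v, longer m v}.
  move=> v; rewrite -(mem_sort longer) sDD inE => /predU1P[->|].
    by rewrite /longer eqxx lexx orbT.
  have := sort_sorted longer_total (D ++ D'); rewrite sDD /=.
  by rewrite (path_sortedE longer_trans) => /andP[/allP h _] /h.
have [mD mD'] : m \in D /\ m \in D'.
  have : m \in D ++ D' by rewrite -(mem_sort longer) sDD mem_head.
  rewrite mem_cat => /orP[mD|mD']; split=> //.
    apply: (longest_mem mD) => // v vD'; by apply: mmin;
      rewrite mem_cat vD' orbT.
  apply: (longest_mem mD') => // [v vD|s t st]; last by rewrite rk.
  by apply: mmin; rewrite mem_cat vD.
have pD := perm_to_rem mD; have pD' := perm_to_rem mD'.
rewrite (permPl pD) perm_sym (permPl pD') perm_cons perm_sym.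
apply: IH.
- move: szD; rewrite (perm_size pD) (perm_size pD') /= addSn addnS !ltnS.
  by apply: leq_trans.
- by move=> u /mem_rem/bD.
- by move=> u /mem_rem/bD'.
move=> s t st; have := rk s t st.
by rewrite !(permP pD, permP pD') /= => /addnI.
Qed.

Lemma barcode_unique (V W : persvect K R) (A B : multiset (dgm_pt R)) :
  is_barcode V A -> is_barcode W B -> pv_iso V W -> A = B.
Proof.
move=> [bA iA] [bB iB] VW.
rewrite -(seq_mset_id A) -(seq_mset_id B);
  apply/eq_seq_msetP/rank_perm_eq => //.
apply: pv_iso_rank; apply: pv_iso_trans (pv_iso_sym iA) (pv_iso_trans VW iB).
Qed.

Lemma diagram_eq (V W : persvect K R) (A : multiset (dgm_pt R)) :
  is_barcode W A -> pv_iso V W -> diagram V = A.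
Proof.
move=> bA VW.
have bVA : is_barcode V A by case: bA => bA iA; split=> //;
  exact: pv_iso_trans iA.
rewrite /diagram; case: xgetP => [B _ /= bB|/(_ A)//].
by apply: barcode_unique bB bA VW.
Qed.

End Uniqueness.

(** * Matchings *)

Section Matchings.
Variable R : realType.
Implicit Types (A B C : dgm_pt R -> nat) (r : R).

(** Two inequalities without subtraction treat infinite coordinates uniformly and compose by adding
    the bounds. *)
Lemma ext_dist_le (s t : \bar R) r : 0 <= r ->
  (ext_dist s t <= r%:E)%E = (s <= t + r%:E)%E && (t <= s + r%:E)%E.
Proof.
move=> r0; rewrite /ext_dist; case: eqVneq => [->|].
  by rewrite lee_fin r0 leeDl ?lee_fin.
case: s t => [x| |] [y| |] //= _; rewrite ?lee_fin //.
- by rewrite ler_norml; apply/andP/andP => -[h1 h2]; split; lra.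
- by rewrite -EFinD !leye_eq /= andbF.
- by rewrite addNye leeNy_eq leye_eq /= andbF.
Qed.

(** A bijection realizing the bound, rather than an infimum at most [r], so that matchings can be
    composed. *)
Definition matching A B r := exists phi,
  set_bij (with_diag A) (with_diag B) phi /\
  forall w, with_diag A w -> (linf_dist w.1 (phi w).1 <= r%:E)%E.

Lemma matching_trans A B C r r' : 0 <= r -> 0 <= r' ->
  matching A B r -> matching B C r' -> matching A C (r + r').
Proof.
move=> r0 r'0 [f [fb fr]] [g [gb gr]]; exists (g \o f); split.
  exact: set_bij_comp gb.
move=> w Aw; have [ffun _ _] := fb.
have /gr := ffun _ Aw; have := fr _ Aw; rewrite /linf_dist !ge_max /=.
rewrite !ext_dist_le ?addr_ge0 // => /andP[/andP[a1 a2] /andP[a3 a4]].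
move=> /andP[/andP[b1 b2] /andP[b3 b4]].
have tr (x y z : \bar R) :
    (x <= y + r%:E -> y <= z + r'%:E -> x <= z + (r + r')%:E)%E.
  by move=> xy yz; rewrite EFinD addeA addeAC (le_trans xy) ?leeD2r.
have tr' (x y z : \bar R) :
    (x <= y + r'%:E -> y <= z + r%:E -> x <= z + (r + r')%:E)%E.
  by move=> xy yz; rewrite EFinD addeA (le_trans xy) ?leeD2r.
by rewrite (tr _ _ _ a1 b1) (tr _ _ _ a3 b3) (tr' _ _ _ b2 a2) (tr' _ _ _ b4 a4).
Qed.

Lemma bottleneck_le A B r : matching A B r -> (bottleneck A B <= r%:E)%E.
Proof.
move=> [phi [phib phir]]; apply: ge_ereal_inf.
exists (ereal_sup [set linf_dist w.1 (phi w).1 | w in with_diag A]%classic).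
  by exists phi.
by apply: ge_ereal_sup => _ [w Aw <-]; apply: phir.
Qed.

Section IndexMatching.
Implicit Types u v : seq (dgm_pt R).
Let p0 : dgm_pt R := (0%E, 0%E).

Definition occ u p := [seq i <- iota 0 (size u) | nth p0 u i == p].

(* If the k-th copy of p in u sits at index i, then slide sends it to the copy
   of v_i sitting at index i of v. The remaining copies of p, which belong to a
   diagram only when p is diagonal, are shifted. *)
Definition slide u v (w : dgm_pt R * nat) : dgm_pt R * nat :=
  let: (p, k) := w in
  if (k < size (occ u p))%N then
    let: i := nth 0%N (occ u p) k in (nth p0 v i, index i (occ v (nth p0 v i)))
  else (p, k - size (occ u p) + size (occ v p))%N.

Lemma size_occ u p : size (occ u p) = count_mem p u.
Proof.
rewrite size_filter -[in RHS](mkseq_nth p0 u) /mkseq count_map.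
by apply: eq_count => i.
Qed.

Lemma mem_occ u p i : (i \in occ u p) = (i < size u)%N && (nth p0 u i == p).
Proof. by rewrite mem_filter mem_iota andbC. Qed.

(** An entry at index [i] of one list is traded for the entry at the same [i] of the other, and the
    shifts of the remaining copies are mutually inverse. *)
Lemma slideK u v : size u = size v -> cancel (slide u v) (slide v u).
Proof.
move=> uv [p k] /=; case: ifPn => [ku|]; last first.
  rewrite -leqNgt => uk /=; rewrite ltnNge leq_addl /= addnK subnK //.
set i := nth 0%N _ _.
have : i \in occ u p by rewrite mem_nth.
rewrite mem_occ => /andP[iu /eqP uip] /=.
have iv : i \in occ v (nth p0 v i) by rewrite mem_occ -uv iu eqxx.
rewrite index_mem iv nth_index // uip index_uniq //.
by rewrite filter_uniq // iota_uniq.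
Qed.

Lemma slide_with_diag u v A B :
  size u = size v ->
  (forall w, with_diag A w <-> w.1.1 = w.1.2 \/ (w.2 < count_mem w.1 u)%N) ->
  (forall w, with_diag B w <-> w.1.1 = w.1.2 \/ (w.2 < count_mem w.1 v)%N) ->
  forall w, with_diag A w -> with_diag B (slide u v w).
Proof.
move=> uv uA vB [p k] /uA /= hw; apply/vB.
case: ifPn => [ku|]; last first.
  by rewrite size_occ; case: hw => [pp|->//] _; left.
set i := nth 0%N _ _; right => /=.
have : i \in occ u p by rewrite mem_nth.
rewrite mem_occ => /andP[iu _].
by rewrite -size_occ index_mem mem_occ -uv iu eqxx.
Qed.

(** [u] and [v] agree with the diagrams only off the diagonal; their diagonal entries are absorbed
    by [with_diag], which leaves room to give both lists the same length. *)
Lemma slide_matching u v A B r : 0 <= r ->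
  size u = size v ->
  (forall w, with_diag A w <-> w.1.1 = w.1.2 \/ (w.2 < count_mem w.1 u)%N) ->
  (forall w, with_diag B w <-> w.1.1 = w.1.2 \/ (w.2 < count_mem w.1 v)%N) ->
  (forall i, (i < size u)%N ->
    (linf_dist (nth p0 u i) (nth p0 v i) <= r%:E)%E) ->
  matching A B r.
Proof.
move=> r0 uv uA vB dr; exists (slide u v); split.
  split.
  - by move=> w Aw; apply: slide_with_diag Aw.
  - by move=> w w' _ _; apply: (can_inj (slideK uv)).
  move=> w Bw; exists (slide v u w); last by rewrite slideK.
  exact: slide_with_diag Bw.
move=> [p k] _ /=; case: ifPn => [ku|_].
  have : nth 0%N (occ u p) k \in occ u p by rewrite mem_nth.
  by rewrite mem_occ => /andP[iu /eqP uip] /=; rewrite -{1}uip dr.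
by rewrite /linf_dist /ext_dist /= !eqxx maxxx lee_fin.
Qed.

(** Each element of [E] pairs its two points. Diagonal points, removed from the multisets, are kept
    in the lists, so both lists have the length of [E]. *)
Lemma matching_of_basis (T : Type) (E : seq T) (f g : T -> dgm_pt R) r :
  0 <= r ->
  (forall e, ((f e).1 <= (f e).2)%E) -> (forall e, ((g e).1 <= (g e).2)%E) ->
  (forall e, (linf_dist (f e) (g e) <= r%:E)%E) ->
  matching (seq_mset [seq f e | e <- E & ((f e).1 < (f e).2)%E])
    (seq_mset [seq g e | e <- E & ((g e).1 < (g e).2)%E]) r.
Proof.
move=> r0 hf hg fg.
have wd (h : T -> dgm_pt R) : (forall e, ((h e).1 <= (h e).2)%E) ->
    forall w,
      with_diag (seq_mset [seq h e | e <- E & ((h e).1 < (h e).2)%E]) w <->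
      w.1.1 = w.1.2 \/ (w.2 < count_mem w.1 (map h E))%N.
  move=> hh [p k]; rewrite /with_diag /= mset_seqE.
  (* Diagonal points belong to both sides; off the diagonal the filter removes no copy of [p]. *)
  have [pp|np] := pselect (p.1 = p.2); first by split; left.
  rewrite !count_map count_filter (@eq_count _ _ (preim h (pred1 p))) // => e /=.
  case: eqP => //= hp; rewrite lt_neqAle hh andbT hp; exact/eqP.
apply: (@slide_matching (map f E) (map g E)) => //; rewrite ?size_map //.
- exact: wd.
- exact: wd.
case: E {wd} => // e0 E i iE.
by rewrite !(nth_map e0) ?fg.
Qed.

End IndexMatching.
End Matchings.

(** * Stability *)

Section Births.
Variable R : realType.

(** The threshold is the least member of [vals] at which [P] holds, or [+oo] if there is none; [P]
    can only become true at a member of [vals]. *)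
Lemma birth_exists (P : {nonneg R} -> bool) (vals : seq {nonneg R}) :
  (forall s t, s <= t -> P s -> P t) ->
  (forall t, exists v, [/\ v \in vals, v <= t & P t -> P v]) ->
  exists b : \bar R, (0 <= b)%E /\ forall t, P t = (b <= t%:num%:E)%E.
Proof.
move=> mono fin; exists (\big[mine/+oo%E]_(v <- vals | P v) v%:num%:E); split.
  elim/big_ind: _ => [|x y x0 y0|v _]; rewrite ?leey // ?le_min ?x0 //.
move=> t; apply/idP/idP => [Pt|].
  have [v [vv vt /(_ Pt) Pv]] := fin t.
  apply: (@le_trans _ _ v%:num%:E); last by rewrite lee_fin.
  exact: ge_bigmin_seq.
apply: contraTT => nPt; rewrite -ltNge.
elim/big_ind: _ => [|x y xt yt|v Pv]; rewrite ?ltry // ?lt_min ?xt //.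
rewrite lte_fin ltNge; apply/negP => vt; case/negP: nPt.
exact: mono Pv.
Qed.

(** For finite [b] this is the last hypothesis at [s = b], a legitimate scale as [b] is
    nonnegative. *)
Lemma birth_shift (P Q : {nonneg R} -> bool) (b c : \bar R) (r : R) : 0 <= r ->
  (0 <= b)%E ->
  (forall t, P t = (b <= t%:num%:E)%E) ->
  (forall t, Q t = (c <= t%:num%:E)%E) ->
  (forall s t : {nonneg R}, t%:num = s%:num + r -> P s -> Q t) ->
  (c <= b + r%:E)%E.
Proof.
move=> r0 b0 Pb Qc PQ; case: b b0 Pb => [x| |] //= x0 Pb; last first.
  by rewrite leey.
pose s := NngNum (x0 : 0 <= x).
pose t := NngNum (addr_ge0 (x0 : 0 <= x) r0).
by rewrite -EFinD -(Qc t); apply: (PQ s) => //; rewrite Pb.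
Qed.

End Births.

(** * Two modules with jointly nested cycles and jointly nested boundaries *)

Section Compatible.
Variables (K : fieldType) (R : realType) (V : vectType K).
Variables (Z B Z' B' : {nonneg R} -> {vspace V}).
Variables (vals : seq {nonneg R}) (r : R).
Hypotheses (sZ : forall s t, s <= t -> (Z s <= Z t)%VS)
  (sB : forall s t, s <= t -> (B s <= B t)%VS)
  (sZ' : forall s t, s <= t -> (Z' s <= Z' t)%VS)
  (sB' : forall s t, s <= t -> (B' s <= B' t)%VS)
  (BZ : forall t, (B t <= Z t)%VS) (BZ' : forall t, (B' t <= Z' t)%VS)
  (finv : forall t, exists v,
    [/\ v \in vals, v <= t, (Z t <= Z v)%VS & (B t <= B v)%VS])
  (finv' : forall t, exists v,
    [/\ v \in vals, v <= t, (Z' t <= Z' v)%VS & (B' t <= B' v)%VS])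
  (chainZ : forall s t, (Z s <= Z' t)%VS || (Z' t <= Z s)%VS)
  (chainB : forall s t, (B s <= B' t)%VS || (B' t <= B s)%VS)
  (r0 : 0 <= r)
  (shift : forall s t : {nonneg R}, t%:num = s%:num + r ->
    [/\ (Z s <= Z' t)%VS, (Z' s <= Z t)%VS, (B s <= B' t)%VS &
        (B' s <= B t)%VS]).

(** Comparability lets the finitely many spaces at [vals] be sorted into one flag; [fullv] is added
    because [two_flags] asks for it. *)
Lemma flag_sort (F F' : {nonneg R} -> {vspace V}) :
  (forall s t, s <= t -> (F s <= F t)%VS) ->
  (forall s t, s <= t -> (F' s <= F' t)%VS) ->
  (forall s t, (F s <= F' t)%VS || (F' t <= F s)%VS) ->
  exists Fs : seq {vspace V},
  [/\ sorted (fun U W => U <= W)%VS Fs, fullv \in Fs,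
    {in vals, forall v, F v \in Fs} & {in vals, forall v, F' v \in Fs}].
Proof.
move=> sF sF' ch; pose L := fullv :: map F vals ++ map F' vals.
have tot : {in L &, total (fun U W : {vspace V} => U <= W)%VS}.
  have cmp U : U \in L ->
      [\/ U = fullv, exists t, U = F t | exists t, U = F' t].
    rewrite inE mem_cat => /predU1P[->|/orP[]/mapP[t _ ->]].
    - by constructor 1.
    - by constructor 2; exists t.
    - by constructor 3; exists t.
  move=> U W /cmp[->|[s ->]|[s ->]] /cmp[->|[t ->]|[t ->]];
    rewrite ?subvf ?orbT //.
  - by have [/sF->|/ltW/sF->] := leP s t; rewrite ?orbT.
  - by rewrite orbC.
  - by have [/sF'->|/ltW/sF'->] := leP s t; rewrite ?orbT.
exists (sort (fun U W => U <= W)%VS L); split.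
- by apply: (sort_sorted_in tot); apply/allP.
- by rewrite mem_sort mem_head.
- by move=> v vv; rewrite mem_sort inE mem_cat map_f // orbT.
- by move=> v vv; rewrite mem_sort inE mem_cat map_f // !orbT.
Qed.

Lemma flag_birth (F : {nonneg R} -> {vspace V}) :
  (forall s t, s <= t -> (F s <= F t)%VS) ->
  (forall t, exists v, [/\ v \in vals, v <= t & (F t <= F v)%VS]) ->
  exists b : V -> \bar R, forall e,
    (0 <= b e)%E /\ forall t, (e \in F t) = (b e <= t%:num%:E)%E.
Proof.
move=> sF fF; suff /choice[b bP] : forall e, exists b,
    (0 <= b)%E /\ forall t, (e \in F t) = (b <= t%:num%:E)%E by exists b.
move=> e; apply: (@birth_exists _ (fun t => e \in F t) vals) => [s t|t].
  by move=> /sF/subvP; apply.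
by have [v [vv vt /subvP h]] := fF t; exists v; split=> //; apply: h.
Qed.

Lemma birth_le_death (b d : \bar R) (P Q : {nonneg R} -> bool) : (0 <= d)%E ->
  (forall t, P t = (b <= t%:num%:E)%E) ->
  (forall t, Q t = (d <= t%:num%:E)%E) ->
  (forall t, Q t -> P t) -> (b <= d)%E.
Proof.
move=> d0 Pb Qd QP.
have := @birth_shift _ Q P d b 0 (lexx _) d0 Qd Pb; rewrite adde0; apply.
by move=> s t; rewrite addr0 => /val_inj-> /QP.
Qed.

(** One basis adapted to both merged flags computes both barcodes, and [shift] bounds the changes of
    birth and death vector by vector. *)
Lemma compatible_matching : exists D D', [/\ is_barcode (sq_pers sZ sB) D,
  is_barcode (sq_pers sZ' sB') D' & matching D D' r].
Proof.
have [Zs [srtZ fullZ ZZs Z'Zs]] := flag_sort sZ sZ' chainZ.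
have [Bs [srtB fullB BBs B'Bs]] := flag_sort sB sB' chainB.
have [E [fE cov ad]] := two_flags srtZ srtB fullZ.
have spanE W : W \in Zs ++ Bs -> (W <= <<[seq e <- E | e \in W]>>)%VS.
  move=> /ad; apply: subv_trans; rewrite subv_cap subvv andbT.
  exact: subv_trans (subvf _) (cov _ fullB).
(* At every scale the space equals that at some member of [vals], to which [E] is adapted. *)
have spanF (F : {nonneg R} -> {vspace V}) t :
    {in vals, forall v, F v \in Zs ++ Bs} ->
    (forall s t, s <= t -> (F s <= F t)%VS) ->
    (exists v, [/\ v \in vals, v <= t & (F t <= F v)%VS]) ->
    (F t <= <<[seq e <- E | e \in F t]>>)%VS.
  move=> FF sF [v [vv vt Ftv]]; rewrite (subv_trans Ftv) //.
  rewrite (subv_trans (spanE _ (FF _ vv))) //; apply: sub_span => e.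
  by rewrite !mem_filter => /andP[ev ->]; rewrite (subvP (sF _ _ vt)).
have finZ t : exists v, [/\ v \in vals, v <= t & (Z t <= Z v)%VS].
  by have [v [vv vt h _]] := finv t; exists v.
have finB t : exists v, [/\ v \in vals, v <= t & (B t <= B v)%VS].
  by have [v [vv vt _ h]] := finv t; exists v.
have finZ' t : exists v, [/\ v \in vals, v <= t & (Z' t <= Z' v)%VS].
  by have [v [vv vt h _]] := finv' t; exists v.
have finB' t : exists v, [/\ v \in vals, v <= t & (B' t <= B' v)%VS].
  by have [v [vv vt _ h]] := finv' t; exists v.
have [bi biP] := flag_birth sZ finZ; have [de deP] := flag_birth sB finB.
have [bi' biP'] := flag_birth sZ' finZ';
  have [de' deP'] := flag_birth sB' finB'.
exists (barcode_of_basis E bi de), (barcode_of_basis E bi' de'); split.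
- apply: sq_barcode => //.
  + by move=> e _; case: (biP e).
  + by move=> e _; case: (biP e).
  + by move=> e _; case: (deP e).
  + by move=> t; apply: spanF => // v vv; rewrite mem_cat ZZs.
  + by move=> t; apply: spanF => // v vv; rewrite mem_cat BBs ?orbT.
- apply: sq_barcode => //.
  + by move=> e _; case: (biP' e).
  + by move=> e _; case: (biP' e).
  + by move=> e _; case: (deP' e).
  + by move=> t; apply: spanF => // v vv; rewrite mem_cat Z'Zs.
  + by move=> t; apply: spanF => // v vv; rewrite mem_cat B'Bs ?orbT.
apply: matching_of_basis => // e /=;
  have [b0 bP] := biP e; have [d0 dP] := deP e;
  have [b'0 bP'] := biP' e; have [d'0 dP'] := deP' e.
- by apply: birth_le_death bP dP _ => // t; apply/subvP.
- by apply: birth_le_death bP' dP' _ => // t; apply/subvP.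
rewrite /linf_dist ge_max !ext_dist_le //=; apply/andP; split; apply/andP;
  split.
- by apply: birth_shift bP' bP _ => // s t /shift[_ /subvP h _ _]; apply: h.
- by apply: birth_shift bP bP' _ => // s t /shift[/subvP h _ _ _]; apply: h.
- by apply: birth_shift dP' dP _ => // s t /shift[_ _ _ /subvP h]; apply: h.
- by apply: birth_shift dP dP' _ => // s t /shift[_ _ /subvP h _]; apply: h.
Qed.

End Compatible.

(** * Stability for two weights on a fixed vertex set *)

Section Weights.
Variables (K : fieldType) (R : realType) (X : finType) (p : nat).
Implicit Types w : X -> X -> R.

(** Unlike a network weight, [w] may vanish off the diagonal, as pulled-back weights do. *)
Definition wt_rel w (t : {nonneg R}) : rel X :=
  fun x y => (x != y) && (w x y <= t%:num).

Fact wt_rel_irr w t : irreflexive (wt_rel w t).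
Proof. by move=> x; rewrite /wt_rel eqxx. Qed.

Definition wt_digraph w t : digraph X := Digraph (wt_rel_irr w t).

Lemma wt_digraphS w s t : s <= t -> subrel (wt_digraph w s) (wt_digraph w t).
Proof. by move=> st x y /andP[xy h]; rewrite /= /wt_rel xy (le_trans h). Qed.

Definition wt_cycles w t := cycles K (wt_digraph w t) p.
Definition wt_boundaries w t := boundaries K (wt_digraph w t) p.

Lemma wt_cyclesS w s t : s <= t -> (wt_cycles w s <= wt_cycles w t)%VS.
Proof. by move=> st; apply/cyclesS/wt_digraphS. Qed.

Lemma wt_boundariesS w s t :
  s <= t -> (wt_boundaries w s <= wt_boundaries w t)%VS.
Proof. by move=> st; apply/boundariesS/wt_digraphS. Qed.

Definition wt_pers w : persvect K R :=
  sq_pers (@wt_cyclesS w) (@wt_boundariesS w).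

Definition inversions w w' : {set (X * X) * (X * X)} :=
  [set e | (w e.1.1 e.1.2 < w e.2.1 e.2.2) &&
           (w' e.2.1 e.2.2 < w' e.1.1 e.1.2)].

Lemma wt_values w : (forall x y, 0 <= w x y) ->
  exists vals : seq {nonneg R}, forall t, exists v,
    [/\ v \in vals, v <= t & subrel (wt_digraph w t) (wt_digraph w v)].
Proof.
move=> w0; pose val x := NngNum (w0 x.1 x.2); pose z := NngNum (lexx (0 : R)).
exists (z :: map val (enum {: X * X})) => t.
(* The largest weight not exceeding [t], or 0 if there is none. *)
pose m := \big[Order.max/z]_(x : X * X | val x <= t) val x.
exists m; split.
- rewrite /m; elim/big_ind: _ => [|a b|x _]; first by rewrite mem_head.
    by rewrite /Num.max; case: ifP.
  by rewrite inE map_f ?orbT // mem_enum.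
- rewrite /m; elim/big_ind: _ => // [|a b at' bt]; first by rewrite -num_le /=.
  by rewrite ge_max at' bt.
move=> x y /andP[xy wt]; rewrite /= /wt_rel xy /=.
have : val (x, y) <= m by apply: (le_bigmax_cond _ (fun x => val x)).
by [].
Qed.

(** If both inclusions failed, an edge present only in the first digraph and one present only in the
    second would form an inversion. *)
Lemma inversions0_chain w w' s t : inversions w w' = finset.set0 ->
  subrel (wt_digraph w s) (wt_digraph w' t) \/
  subrel (wt_digraph w' t) (wt_digraph w s).
Proof.
move=> inv0.
have [|no] := pselect (subrel (wt_digraph w s) (wt_digraph w' t));
  first by left.
right.
move=> c d /= /andP[cd w'cd]; rewrite /wt_rel cd /= leNgt; apply/negP => swcd.
apply: no => a b /= /andP[ab wab]; rewrite /wt_rel ab /= leNgt;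
  apply/negP => tw'ab.
have : ((a, b), (c, d)) \in inversions w w'.
  by rewrite inE /= (le_lt_trans wab) // (le_lt_trans w'cd).
by rewrite inv0 inE.
Qed.

Lemma wt_stability0 w w' r :
  (forall x y, 0 <= w x y) -> (forall x y, 0 <= w' x y) -> 0 <= r ->
  (forall x y, `|w x y - w' x y| <= r) -> inversions w w' = finset.set0 ->
  exists D D', [/\ is_barcode (wt_pers w) D, is_barcode (wt_pers w') D' &
    matching D D' r].
Proof.
move=> w0 w'0 r0 ww' inv0.
have [vals valsP] := wt_values w0; have [vals' valsP'] := wt_values w'0.
have shiftP u u' s t : (forall x y, `|u x y - u' x y| <= r) ->
    t%:num = s%:num + r ->
    subrel (wt_digraph u s) (wt_digraph u' t).
  move=> uu' ts x y /= /andP[xy us]; rewrite /wt_rel xy /= ts.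
  by have := uu' x y; rewrite ler_norml => /andP[h1 h2]; lra.
apply: (@compatible_matching _ _ _ _ _ _ _ (vals ++ vals')) => //.
- by move=> t; apply: boundaries_sub_cycles.
- by move=> t; apply: boundaries_sub_cycles.
- move=> t; have [v [vv vt h]] := valsP t; exists v; split=> //;
    first by rewrite mem_cat vv.
    exact: cyclesS.
  exact: boundariesS.
- move=> t; have [v [vv vt h]] := valsP' t; exists v; split=> //;
    first by rewrite mem_cat vv orbT.
    exact: cyclesS.
  exact: boundariesS.
- move=> s t; apply/orP.
  by case: (inversions0_chain s t inv0) => h; [left|right]; apply: cyclesS.
- move=> s t; apply/orP.
  by case: (inversions0_chain s t inv0) => h; [left|right]; apply: boundariesS.
move=> s t ts; have w'w x y : `|w' x y - w x y| <= r by rewrite distrC.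
by split; [apply: cyclesS|apply: cyclesS|apply: boundariesS|apply: boundariesS];
  apply: shiftP ts.
Qed.

Lemma wt_stability w w' r :
  (forall x y, 0 <= w x y) -> (forall x y, 0 <= w' x y) -> 0 <= r ->
  (forall x y, `|w x y - w' x y| <= r) ->
  exists D D', [/\ is_barcode (wt_pers w) D, is_barcode (wt_pers w') D' &
    matching D D' r].
Proof.
have [n] := ubnP #|inversions w w'|; elim: n => // n IH in w r *.
move=> szn w0 w'0 r0 ww'.
have [inv0|[e0 e0inv]] := set_0Vmem (inversions w w');
  first exact: wt_stability0.
(* Along the segment from w to w', the two values compared by the inversion e
   become equal at time tau e. *)
pose tau (e : (X * X) * (X * X)) : R :=
  (w e.2.1 e.2.2 - w e.1.1 e.1.2) /
  ((w e.2.1 e.2.2 - w e.1.1 e.1.2) + (w' e.1.1 e.1.2 - w' e.2.1 e.2.2)).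
have [e einv emin] :=
  @arg_minP _ _ _ e0 (fun e => e \in inversions w w') tau e0inv.
set c := tau e.
have tauP e' : e' \in inversions w w' -> [/\ 0 < tau e', tau e' < 1 &
    tau e' * ((w e'.2.1 e'.2.2 - w e'.1.1 e'.1.2) +
              (w' e'.1.1 e'.1.2 - w' e'.2.1 e'.2.2)) =
    w e'.2.1 e'.2.2 - w e'.1.1 e'.1.2].
  rewrite inE => /andP[]; rewrite -subr_gt0 => d1; rewrite -subr_gt0 /tau => d2.
  have d12 : 0 < w e'.2.1 e'.2.2 - w e'.1.1 e'.1.2 +
      (w' e'.1.1 e'.1.2 - w' e'.2.1 e'.2.2).
    exact: addr_gt0.
  split; first exact: divr_gt0.
    by rewrite ltr_pdivrMr // mul1r ltrDl.
  by rewrite divfK // gt_eqF.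
have [c0 c1 cE] := tauP _ einv; rewrite -/c in c0 c1 cE.
(* The weight at the time [c] of the first crossing, within [c * r] of [w] and [(1 - c) * r] of
   [w']. *)
pose u x y := w x y + c * (w' x y - w x y).
have uE x y : u x y = (1 - c) * w x y + c * w' x y by rewrite /u; ring.
have u0 x y : 0 <= u x y.
  by rewrite uE addr_ge0 // mulr_ge0 // ?subr_ge0 ltW.
have wu x y : `|w x y - u x y| <= c * r.
  rewrite (_ : _ - _ = c * (w x y - w' x y)); last by rewrite /u; ring.
  by rewrite normrM (gtr0_norm c0) ler_pM2l.
have uw' x y : `|u x y - w' x y| <= (1 - c) * r.
  rewrite (_ : _ - _ = (1 - c) * (w x y - w' x y)); last by rewrite /u; ring.
  by rewrite normrM gtr0_norm ?subr_gt0 // ler_pM2l ?subr_gt0.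
(* An inversion between [w] and [u] would be one between [w] and [w'] crossing before [c], the least
   crossing time. *)
have inv_wu : inversions w u = finset.set0.
  apply/setP => e'; rewrite !inE; apply/negP => /andP[we ue].
  have e'inv : e' \in inversions w w'.
    rewrite inE we /=; rewrite !uE in ue; nra.
  have [t0 t1 tE] := tauP _ e'inv; have := emin _ e'inv; rewrite -/c => ct.
  rewrite /u in ue; move: e'inv; rewrite inE => /andP[_ w'e].
  nra.
(* Every inversion left between [u] and [w'] was one between [w] and [w'], and [e] is no longer one,
   since its two values agree at time [c]. *)
have lt_inv : (#|inversions u w'| < #|inversions w w'|)%N.
  apply/proper_card/properP; split.
    apply/fintype.subsetP => e'; rewrite !inE => /andP[ue w'e];
      rewrite w'e andbT.
    rewrite !uE in ue; nra.
  exists e => //; rewrite inE negb_and; apply/orP; left; rewrite -leNgt /u.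
  nra.
have cr0 : 0 <= c * r by rewrite mulr_ge0 // ltW.
have cr'0 : 0 <= (1 - c) * r by rewrite mulr_ge0 // subr_ge0 ltW.
have [D [D1 [bD bD1 m1]]] := wt_stability0 w0 u0 cr0 wu inv_wu.
have [D2 [D' [bD2 bD' m2]]] :=
  IH u ((1 - c) * r) (leq_trans lt_inv szn) u0 w'0 cr'0 uw'.
exists D, D'; split=> //.
(* Both are barcodes of the module of [u]. *)
have D12 : D1 = D2.
  have [_ uD2] := bD2.
  exact: barcode_unique bD1 bD2 (pv_iso_trans uD2 (pv_iso_sym uD2)).
have -> : r = c * r + (1 - c) * r by ring.
by apply: matching_trans m1 _ => //; rewrite D12.
Qed.

End Weights.

(** * Isomorphisms induced by maps inverse modulo boundaries *)

Section SubquotientIso.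
Variables (K : fieldType) (R : realType) (V V' : vectType K).
Variables (Z B : {nonneg R} -> {vspace V}) (Z' B' : {nonneg R} -> {vspace V'}).
Hypotheses (sZ : forall s t, s <= t -> (Z s <= Z t)%VS)
  (sB : forall s t, s <= t -> (B s <= B t)%VS)
  (sZ' : forall s t, s <= t -> (Z' s <= Z' t)%VS)
  (sB' : forall s t, s <= t -> (B' s <= B' t)%VS).
Variables (f : 'Hom(V, V')) (g : 'Hom(V', V)).
Hypotheses (fZ : forall t, {in Z t, forall z, f z \in Z' t})
  (fB : forall t, {in B t, forall z, f z \in B' t})
  (gZ : forall t, {in Z' t, forall z, g z \in Z t})
  (gB : forall t, {in B' t, forall z, g z \in B t})
  (gf : forall t, {in Z t, forall z, g (f z) - z \in B t})
  (fg : forall t, {in Z' t, forall z, f (g z) - z \in B' t}).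

(** As [f] and [g] do not depend on [t], naturality can be checked on representatives. *)
Lemma sq_pers_iso : pv_iso (sq_pers sZ sB) (sq_pers sZ' sB').
Proof.
pose phi t (q : subquot (Z t) (B t)) : subquot (Z' t) (B' t) :=
  pi_sq (B' t) (vsproj (Z' t) (f (vsval (repr q)))).
have phi_pi t (z : subvs_of (Z t)) :
    phi t (pi_sq (B t) z) = pi_sq (B' t) (vsproj (Z' t) (f (vsval z))).
  apply/pi_sqP; rewrite !vsprojK ?fZ ?subvsP // -linearB /=.
  by apply/fB/pi_sqP/repr_sqK.
have phi_lin t : linear (phi t).
  move=> a q q'; rewrite -[q]repr_sqK -[q']repr_sqK -linearP !phi_pi.
  by rewrite !linearP.
exists (fun t => linear_pack (phi_lin t)); split=> [t|s t h q] /=.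
  exists (fun q => pi_sq (B t) (vsproj (Z t) (g (vsval (repr q))))) => q.
    rewrite -[q]repr_sqK phi_pi; set z := repr q.
    apply/pi_sqP; rewrite vsprojK ?gZ ?subvsP //.
    rewrite -(subrK (g (f (vsval z))) (g _)) -addrA memvD ?gf ?subvsP // -linearB gB //.
    have /pi_sqP := repr_sqK (pi_sq (B' t) (vsproj (Z' t) (f (vsval z)))).
    by rewrite [X in _ - X]vsprojK // fZ ?subvsP.
  rewrite phi_pi -[RHS]repr_sqK; apply/pi_sqP.
  by rewrite !vsprojK ?fZ ?gZ ?subvsP // fg ?subvsP.
rewrite -[q]repr_sqK; set z := repr q.
transitivity (phi t (pi_sq (B t) (vsproj (Z t) (vsval z)))).
  by congr phi; apply: subquot_map_pi; [exact: sZ | exact: sB].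
rewrite !phi_pi [RHS]subquot_map_pi; [|exact: sZ'|exact: sB'].
by rewrite !vsprojK // ?(subvP (sZ h)) ?fZ ?subvsP.
Qed.

End SubquotientIso.

(** * Pullback of a network along a surjection with a section *)

Section PullBack.
Variables (K : fieldType) (R : realType).
Variables (X : network R) (T : finType) (p : nat).
Variables (pr : T -> X) (sec : X -> T).
Hypothesis secK : cancel sec pr.

Lemma pers_path_homology_pullback :
  pv_iso (pers_path_homology K X p)
    (wt_pers K p (fun a b => net_wt (pr a) (pr b))).
Proof.
set w := fun a b => net_wt (pr a) (pr b).
(* The module of the weight [net_wt] is [pers_path_homology] up to proofs, so identities give this
   isomorphism. *)
apply: (@pv_iso_trans _ _ _ (wt_pers K p (@net_wt _ X))).
  by exists (fun t => idfun); split=> [t|s t h v] //; exists idfun.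
have sec_map t : digraph_map (wt_digraph (@net_wt _ X) t) (wt_digraph w t) sec.
  move=> a b /= /andP[ab wab]; rewrite /weak_edge /= /wt_rel /w !secK wab andbT.
  by rewrite orbN.
have pr_map t : digraph_map (wt_digraph w t) (wt_digraph (@net_wt _ X) t) pr.
  move=> a b /= /andP[ab wab];
    rewrite /weak_edge /= /wt_rel -/(w a b) wab andbT.
  by rewrite orbN.
apply: (@sq_pers_iso _ _ _ _ _ _ _ _ _ _ _ _
  (rpush K sec p.+1) (rpush K pr p.+1)).
- by move=> t z; apply: rpush_cycles.
- by move=> t z; apply: rpush_boundaries.
- by move=> t z; apply: rpush_cycles.
- by move=> t z; apply: rpush_boundaries.
- move=> t z zZ; rewrite rpush_comp (_ : pr \o sec = id); last by apply/funext.
  by rewrite rpush_id (cycles_regular zZ) subrr mem0v.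
(* The cycle [z] is regular, hence its own image under [rpush] of the identity, which is to be
   compared with [sec \o pr]. *)
move=> t z zZ; rewrite rpush_comp -[X in _ - X](cycles_regular zZ) -rpush_id.
apply: (homotopic_cycles (G := wt_digraph w t)) => //.
- by move=> a b; rewrite /weak_edge => ->; rewrite orbT.
- move=> a b ab; rewrite /=; have /orP[/eqP->|] := pr_map _ _ _ ab.
    by rewrite /weak_edge eqxx.
  exact: sec_map.
(* [a] and [sec (pr a)] have the same projection, so the weight between them is 0 and they are equal
   or joined at every scale. *)
move=> a; rewrite /weak_edge /= /wt_rel /w secK.
rewrite (_ : net_wt _ _ = 0); last exact/net_wt_eq0.
by rewrite ge0 andbT orbN.
Qed.

End PullBack.

Unset Implicit Arguments.

Theorem theorem15 (R : realType) (K : fieldType) (X Y : network R) (p : nat) :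
  (bottleneck (Dgm K X p) (Dgm K Y p) <= (2 * dN X Y)%:E)%E.
Proof.
rewrite /dN mulrA mulfV ?mul1r ?pnatr_eq0 //.
case: arg_minP => [|C /andP[/forallP CX /forallP CY] _].
  (* The minimum is over a nonempty set: the full relation is a correspondence. *)
  have /card_gt0P[x0 _] := net_pt_neq0 X;
    have /card_gt0P[y0 _] := net_pt_neq0 Y.
  apply/andP; split; apply/forallP => z; apply/existsP.
    by exists y0; rewrite inE.
  by exists x0; rewrite inE.
(* The minimizing correspondence itself is the common vertex set; sections of its two projections
   are chosen next. *)
pose T := {u : X * Y | u \in C}.
have /choice[sX sXK] : forall x, exists u : T, (val u).1 = x.
  by move=> x; have /existsP[y xy] := CX x; exists (Sub (x, y) xy).
have /choice[sY sYK] : forall y, exists u : T, (val u).2 = y.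
  by move=> y; have /existsP[x xy] := CY y; exists (Sub (x, y) xy).
have isoX := pers_path_homology_pullback K (pr := fun u : T => (val u).1) p sXK.
have isoY := pers_path_homology_pullback K (pr := fun u : T => (val u).2) p sYK.
have dis_ge (u v : T) :
    `|net_wt (val u).1 (val v).1 - net_wt (val u).2 (val v).2| <= dis C.
  rewrite /dis; apply: le_trans (le_bigmax_cond _ _ (valP u)).
  exact: (le_bigmax_cond _ _ (valP v)).
have dis0 : 0 <= dis C by rewrite /dis bigmax_ge_id.
have [D [D' [bD bD' m]]] := @wt_stability K R T p _ _ _
  (fun u v => net_wt_ge0 (val u).1 (val v).1)
  (fun u v => net_wt_ge0 (val u).2 (val v).2)
  dis0 dis_ge.
rewrite /Dgm (diagram_eq bD isoX) (diagram_eq bD' isoY).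
exact: bottleneck_le.
Qed.
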